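(* $\mathrm{SSCM}(0,*;3;*,* )=\mathrm{RE}$. That is, a language is recursively enumerable if and only if it is generated by an SCM grammar with all of the following properties: - at most $3$ nonterminals; - every matrix has $P=\emptyset$, so there are no permitting conditions, while forbidden strings may be of arbitrary length; - an arbitrary finite number of conditional matrices; - matrices of arbitrary finite length.
   Context: A semi-conditional matrix (SCM) grammar is a quadruple $G=(V,T,M,S)$ with the following components. - $V$ is a finite alphabet and $T\subsetneq V$ is the set of terminals. - $N=V\setminus T$ is the set of nonterminals and $S\in N$ is the start symbol. - $M$ is a finite set of matrices of the form $r=[(A_1\to x_1),\dots,(A_\ell\to x_\ell),P,F]$, where $\ell\ge 1$, $A_k\in N$, $x_k\in V^*$, and $P,F\in V^+\cup\{\emptyset\}$. Here $\emptyset\notin V$ is a special symbol meaning that the condition is absent, and $|\emptyset|=0$. The number $\ell$ is the length of $r$. A matrix is classified as follows: - unconditional if $P=F=\emptyset$, and conditional otherwise; - simple if at least one of $P,F$ equals $\emptyset$, and non-simple if both $P\neq\emptyset$ and $F\neq\emptyset$. For $x,y\in V^*$ we write $x\Rightarrow_r y$ iff all of the following hold: 1. if $P\neq\emptyset$ then $P$ is a subword (factor) of $x$; 2. if $F\neq\emptyset$ then $F$ is not a subword of $x$; 3. there are words $x=y_0,y_1,\dots,y_\ell=y$ such that $y_k$ is obtained from $y_{k-1}$ by replacing one occurrence of $A_k$ by $x_k$. $\Rightarrow_G$ is the union of the relations $\Rightarrow_r$ over $r\in M$, and $L(G)=\{y\in T^*: S\Rightarrow_G^* y\}$. $G$ has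 degree $(i,j)$ if every matrix satisfies $|P|\le i$ and $|F|\le j$. $\mathrm{SCM}(i,j;n;m,\ell,s)$ denotes the family of languages $L(G)$ of SCM grammars $G$ that satisfy all of the following: - $G$ has degree $(i,j)$; - $|N|\le n$; - $G$ has at most $m$ conditional matrices; - every matrix of $G$ has length at most $\ell$; - $G$ has at most $s$ non-simple matrices. A $*$ in a parameter position means that parameter is unbounded. $\mathrm{SSCM}(i,j;n;m,\ell)=\mathrm{SCM}(i,j;n;m,\ell,0)$, i.e., all matrices are simple. $\mathrm{RE}$ is the class of recursively enumerable languages. *)

(* Defs.v *)
From Stdlib Require Import Relations.
From mathcomp Require Import all_boot.
From Stdlib Require List.
Set Implicit Arguments. Unset Strict Implicit. Unset Printing Implicit Defensive.

(* Bounds: [None] stands for the unbounded parameter "*". *)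
Definition le_opt (b : option nat) (k : nat) : Prop :=
  match b with None => True | Some b => (k <= b)%N end.

(* |P| for P in V^+ \cup {emptyset}, with |emptyset| = 0 *)
Definition optlen (V : Type) (o : option (seq V)) : nat :=
  match o with None => 0 | Some s => size s end.

Definition factor (V : Type) (P x : seq V) : Prop :=
  exists u v, x = u ++ P ++ v.

(* Symbols V = T + N with nonterminals N = 'I_n ; [None] encodes emptyset. *)
Record scm_matrix (V N : Type) := SCMMatrix {
  rules  : seq (N * seq V);
  permit : option (seq V);
  forbid : option (seq V)
}.

Record scm_grammar (T : Type) (n : nat) := SCMGrammar {
  scm_start : 'I_n;
  scm_matrices : seq (scm_matrix (T + 'I_n) 'I_n)
}.

Definition scm_matrix_wf (V N : Type) (r : scm_matrix V N) : Prop :=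
  rules r <> [::] /\ permit r <> Some [::] /\ forbid r <> Some [::].

Definition scm_grammar_wf (T : Type) (n : nat) (G : scm_grammar T n) : Prop :=
  List.NoDup (scm_matrices G) /\
  (forall r, List.In r (scm_matrices G) -> scm_matrix_wf r).

Definition rewrite1 (T N : Type) (A : N) (w x y : seq (T + N)) : Prop :=
  exists u v, x = u ++ inr A :: v /\ y = u ++ w ++ v.

Inductive apply_rules (T N : Type) : seq (N * seq (T + N)) -> seq (T + N) -> seq (T + N) -> Prop :=
| apply_nil x : apply_rules [::] x x
| apply_cons A w rs x z y :
    rewrite1 A w x z -> apply_rules rs z y -> apply_rules ((A, w) :: rs) x y.

Definition matrix_step (T N : Type) (r : scm_matrix (T + N) N) (x y : seq (T + N)) : Prop :=
  (forall P, permit r = Some P -> factor P x) /\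
  (forall F, forbid r = Some F -> ~ factor F x) /\
  apply_rules (rules r) x y.

Definition scm_step (T : Type) (n : nat) (G : scm_grammar T n) (x y : seq (T + 'I_n)) : Prop :=
  exists r, List.In r (scm_matrices G) /\ matrix_step r x y.

Definition scm_language (T : Type) (n : nat) (G : scm_grammar T n) (w : seq T) : Prop :=
  clos_refl_trans _ (@scm_step T n G) [:: inr (scm_start G)] (map inl w).

Definition conditionalb (V N : Type) (r : scm_matrix V N) : bool :=
  isSome (permit r) || isSome (forbid r).
Definition nonsimpleb (V N : Type) (r : scm_matrix V N) : bool :=
  isSome (permit r) && isSome (forbid r).

Definition SCM (i j nn m l s : option nat) (T : finType) (L : seq T -> Prop) : Prop :=
  exists (n : nat) (G : scm_grammar T n),
    scm_grammar_wf G /\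
    (forall r, List.In r (scm_matrices G) ->
       le_opt i (optlen (permit r)) /\ le_opt j (optlen (forbid r)) /\
       le_opt l (size (rules r))) /\
    le_opt nn n /\
    le_opt m (size (filter (@conditionalb _ _) (scm_matrices G))) /\
    le_opt s (size (filter (@nonsimpleb _ _) (scm_matrices G))) /\
    (forall w, L w <-> scm_language G w).

Definition SSCM (i j nn m l : option nat) (T : finType) (L : seq T -> Prop) : Prop :=
  SCM i j nn m l (Some 0) L.

(* RE = languages generated by phrase-structure (type-0, unrestricted) grammars *)
Record ps_grammar (T : Type) (n : nat) := PSGrammar {
  ps_start : 'I_n;
  ps_prods : seq (seq (T + 'I_n) * seq (T + 'I_n))
}.

Definition ps_grammar_wf (T : Type) (n : nat) (G : ps_grammar T n) : Prop :=
  forall p, List.In p (ps_prods G) -> exists A, List.In (inr A) p.1.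

Definition ps_step (T : Type) (n : nat) (G : ps_grammar T n) (x y : seq (T + 'I_n)) : Prop :=
  exists lhs rhs u v, List.In (lhs, rhs) (ps_prods G) /\
    x = u ++ lhs ++ v /\ y = u ++ rhs ++ v.

Definition ps_language (T : Type) (n : nat) (G : ps_grammar T n) (w : seq T) : Prop :=
  clos_refl_trans _ (@ps_step T n G) [:: inr (ps_start G)] (map inl w).

Definition RE (T : finType) (L : seq T -> Prop) : Prop :=
  exists (n : nat) (G : ps_grammar T n),
    ps_grammar_wf G /\ (forall w, L w <-> ps_language G w).

(* Main.v *)
From Stdlib Require Import Relations.
Require Import Defs.
From mathcomp Require Import all_boot zify.
From Stdlib Require List.
Set Implicit Arguments. Unset Strict Implicit. Unset Printing Implicit Defensive.

(* From a grammar to an SCM grammar with nonterminals A, B, C: the grammar is run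
   backwards on a guessed terminal word that is cut between two stacks, each stack being a
   number in a fixed base. A rewriting or a move of the cut replaces a number d k + r by
   e k + s, which counters can do with one auxiliary counter at 0. The resulting three
   counters x, y, z are held as the single number 2^x 3^y 5^z, on which their operations are
   again of the form d k + r -> e k + s, so that two counters suffice. They are the numbers
   of A's and of B's in words y C^n, where n encodes the control state: a matrix that erases
   exactly n letters C and forbids C^(n+1) acts in state n only, and since A, B as forbidden
   strings test a counter for zero without looking at n, such a test adds a multiple of
   a large constant to n as a certificate.

   From an SCM grammar without permitting conditions to a grammar: a head between two end
   markers first scans the word to see that the forbidden string does not occur, and then
   walks freely to apply the rules of the matrix one after the other. *)

(** * Reflexive-transitive closures and membership in lists *)

Notation star := (clos_refl_trans _).

Lemma star_inv (X : Type) (R : relation X) (P : X -> Prop) a b :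
  (forall x y, P x -> R x y -> P y) -> star R a b -> P a -> P b.
Proof. by move=> PR; elim=> // [x y Rxy Px|x y z _ IH1 _ IH2 /IH1]; [exact: PR Rxy|]. Qed.

Lemma star_sim (X Y : Type) (R : relation X) (S : relation Y) (f : X -> Y) a b :
  (forall x y, R x y -> star S (f x) (f y)) -> star R a b -> star S (f a) (f b).
Proof.
move=> RS; elim=> [x y /RS //|x|x y z _ IH1 _ IH2]; first exact: rt_refl.
exact: rt_trans IH1 IH2.
Qed.

Lemma star_r (X : Type) (R : relation X) a b c : star R a b -> R b c -> star R a c.
Proof. by move=> ab bc; apply: rt_trans ab _; apply: rt_step. Qed.

Lemma star_l (X : Type) (R : relation X) a b c : R a b -> star R b c -> star R a c.
Proof. by move=> ab bc; apply: rt_trans bc; apply: rt_step. Qed.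

Lemma In_mem (X : eqType) (x : X) (s : seq X) : List.In x s <-> x \in s.
Proof.
elim: s => [|y s IH] //=; rewrite inE; split.
  by case=> [->|/IH->]; rewrite ?eqxx ?orbT.
by case/orP=> [/eqP->|/IH]; [left | right].
Qed.

Lemma In_map_mem (X : eqType) (Y : Type) (f : X -> Y) (s : seq X) y :
  List.In y (map f s) <-> exists2 x, x \in s & y = f x.
Proof.
elim: s => [|x s IH] /=; first by split=> // -[].
split=> [[<-|H]|[z]].
- by exists x; rewrite // mem_head.
- have [z zs ->] := IH.1 H; by exists z; rewrite // inE zs orbT.
- rewrite inE => /orP[/eqP-> ->|zs yE]; [by left | by right; apply/IH; exists z].
Qed.

Lemma NoDup_map_uniq (X : eqType) (Y : Type) (f : X -> Y) (s : seq X) :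
  injective f -> uniq s -> List.NoDup (map f s).
Proof.
move=> fi; elim: s => [|x s IH] /=; first by constructor.
case/andP=> xs us; constructor; last exact: IH.
by case/In_map_mem=> z zs /fi xz; rewrite xz zs in xs.
Qed.

(** * Register machines that write a word *)

Section Machines.
Variable T : countType.

Section Semantics.
Variables (V : Type) (Op Q : eqType) (sem : Op -> V -> V -> Prop).

Inductive mstep (tr : seq (Q * seq T * Op * Q)) :
    Q * V * seq T -> Q * V * seq T -> Prop :=
  MStep q o p q' v v' w of (q, o, p, q') \in tr & sem p v v' :
    mstep tr (q, v, w) (q', v', w ++ o).

Lemma mstep0 tr q p q' v v' w :
  (q, [::], p, q') \in tr -> sem p v v' -> mstep tr (q, v, w) (q', v', w).
Proof. by move=> tin vv'; rewrite -{2}[w]cats0; apply: MStep tin vv'. Qed.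

(** Runs must return to the initial contents. With registers at zero, this is what later leaves no
    counter letter in the generated word. *)
Definition mlang tr (q0 qf : Q) (v0 : V) (w : seq T) : Prop :=
  star (mstep tr) (q0, v0, [::]) (qf, v0, w).

End Semantics.

Definition regs (I : finType) : countType := {ffun I -> nat}.
Definition zero (I : finType) : regs I := [ffun => 0].
Definition upd (I : finType) (v : regs I) i n : regs I :=
  [ffun j => if j == i then n else v j].

(* [(i, (d, r, e, s))] replaces the contents [d * k + r] of register [i] by [e * k + s]. *)
Definition affine (I : finType) : countType := (I * (nat * nat * nat * nat))%type.
Definition asem (I : finType) (p : affine I) (v v' : regs I) : Prop :=
  let: (i, (d, r, e, s)) := p in
  exists k, v i = d * k + r /\ v' = upd v i (e * k + s).

(* [inl (a, b)] subtracts [a] and then adds [b]; [inr i] tests register [i] for zero. *)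
Definition counter (I : finType) : countType := (regs I * regs I + I)%type.
Definition csem (I : finType) (p : counter I) (v v' : regs I) : Prop :=
  match p with
  | inl (a, b) => (forall i, a i <= v i) /\ v' = [ffun i => v i - a i + b i]
  | inr i => v i = 0 /\ v' = v
  end.

Definition affine_lang (I : finType) (L : seq T -> Prop) : Prop :=
  exists (Q : countType) (tr : seq (Q * seq T * affine I * Q)) (q0 qf : Q),
    forall w, L w <-> mlang (@asem I) tr q0 qf (zero I) w.

Definition counter_lang (I : finType) (L : seq T -> Prop) : Prop :=
  exists (Q : countType) (tr : seq (Q * seq T * counter I * Q)) (q0 qf : Q),
    forall w, L w <-> mlang (@csem I) tr q0 qf (zero I) w.

Lemma upd_id (I : finType) (v : regs I) i : upd v i (v i) = v.
Proof. by apply/ffunP=> j; rewrite ffunE; case: eqP => [->|]. Qed.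

(** * Affine replacements by counters, with one auxiliary counter *)

Section AffineToCounter.
Variables (I : finType) (Q : countType).
Variables (tr : seq (Q * seq T * affine I * Q)) (q0 qf : Q).

Definition ext (v : regs I) z : regs (option I) :=
  [ffun o => if o is Some j then v j else z].
Definition one (J : finType) (i : J) n : regs J := [ffun j => if j == i then n else 0].

(** An inner state carries its whole transition and a phase, so that the gadgets of different
    transitions never mix. *)
Definition gstate : countType := (Q + (Q * seq T * affine I * Q) * nat)%type.

(** Phase 0 trades [d] units of register [i] for [e] auxiliary units any number of times, then [r]
    for [s] once. The zero test in phase 1 certifies that the contents were exactly [d * k + r];
    phase 2 moves the result back. *)
Definition gadget (t : Q * seq T * affine I * Q) :
    seq (gstate * seq T * counter (option I) * gstate) :=
  let: (q, o, (i, (d, r, e, s)), q') := t in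
  [:: (inl q, o, inl (zero _, zero _), inr (t, 0));
      (inr (t, 0), [::], inl (one (Some i) d, one None e), inr (t, 0));
      (inr (t, 0), [::], inl (one (Some i) r, one None s), inr (t, 1));
      (inr (t, 1), [::], inr (Some i), inr (t, 2));
      (inr (t, 2), [::], inl (one None 1, one (Some i) 1), inr (t, 2));
      (inr (t, 2), [::], inr None, inl q')].

Definition gtrans := flatten [seq gadget t | t <- tr].

Lemma ext_inj v z v' z' : ext v z = ext v' z' -> v = v' /\ z = z'.
Proof.
move=> E; split; last by move/ffunP/(_ None): E; rewrite !ffunE.
by apply/ffunP=> j; move/ffunP/(_ (Some j)): E; rewrite !ffunE.
Qed.

Lemma csem_zero (J : finType) (v v' : regs J) :
  csem (inl (zero J, zero J)) v v' <-> v' = v.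
Proof.
have E : v = [ffun i => v i - zero J i + zero J i].
  by apply/ffunP=> i; rewrite !ffunE subn0 addn0.
by split=> [[_ ->]|->]; [rewrite -E | split=> // i; rewrite ffunE].
Qed.

Lemma csem_dec v i n z a b v' :
  csem (inl (one (Some i) a, one None b)) (ext (upd v i n) z) v' <->
  a <= n /\ v' = ext (upd v i (n - a)) (z + b).
Proof.
split=> [[le ->]|[le ->]]; split.
- by move: (le (Some i)); rewrite !ffunE !eqxx.
- apply/ffunP=> -[j|]; rewrite !ffunE /= ?subn0 // addn0.
  by rewrite (inj_eq Some_inj); case: eqP; rewrite ?subn0.
- case=> [j|]; rewrite !ffunE //= (inj_eq Some_inj); case: eqP => //.
- apply/ffunP=> -[j|]; rewrite !ffunE /= ?subn0 // addn0.
  by rewrite (inj_eq Some_inj); case: eqP; rewrite ?subn0.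
Qed.

Lemma csem_inc v i n z a b v' :
  csem (inl (one None a, one (Some i) b)) (ext (upd v i n) z) v' <->
  a <= z /\ v' = ext (upd v i (n + b)) (z - a).
Proof.
split=> [[le ->]|[le ->]]; split.
- by move: (le None); rewrite !ffunE.
- apply/ffunP=> -[j|]; rewrite !ffunE /= ?addn0 // subn0.
  by rewrite (inj_eq Some_inj); case: eqP; rewrite ?addn0.
- by case=> [j|]; rewrite !ffunE.
- apply/ffunP=> -[j|]; rewrite !ffunE /= ?addn0 // subn0.
  by rewrite (inj_eq Some_inj); case: eqP; rewrite ?addn0.
Qed.

Let reach := star (mstep (@asem I) tr) (q0, zero I, [::]).

(** Inside a gadget, [v] and [w0] are the contents and the output at its entry, [k] the number of
    rounds of the first loop, and [n], [z] the current values of register [i] and of the auxiliary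
    counter. *)
Definition ginv (c : gstate * regs (option I) * seq T) : Prop :=
  let: (g, x, w) := c in
  match g with
  | inl q => exists2 v, x = ext v 0 & reach (q, v, w)
  | inr ((q, o, (i, (d, r, e, s)), q') as t, ph) =>
    t \in tr /\ exists v w0 k n z,
      [/\ w = w0 ++ o, reach (q, v, w0), x = ext (upd v i n) z &
       match ph with
       | 0 => v i = n + d * k /\ z = e * k
       | 1 => v i = n + d * k + r /\ z = e * k + s
       | _ => v i = d * k + r /\ n + z = e * k + s
       end]
  end.

Lemma ginv_step c c' : ginv c -> mstep (@csem _) gtrans c c' -> ginv c'.
Proof.
move=> H S; case: S H => {c c'} g o p g' x x' w /flatten_mapP[].
case=> [[[q o'] [i [[[d r] e] s]]] q'] tin; rewrite !inE.
case/or4P; [|..|case/or3P]; case/eqP=> -> -> -> -> {g o p g'}; rewrite ?cats0.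
- move/csem_zero=> -> [v -> rv]; split=> //.
  by exists v, w, 0, (v i), 0; rewrite !muln0 addn0 upd_id.
- move=> S [_ [v] [w0] [k] [n] [z] [-> rv xE [vi zE]]]; split=> //.
  move: S; rewrite xE => /csem_dec[le ->].
  exists v, w0, k.+1, (n - d), (z + e); split=> //.
  by rewrite vi zE !mulnS; split; lia.
- move=> S [_ [v] [w0] [k] [n] [z] [-> rv xE [vi zE]]]; split=> //.
  move: S; rewrite xE => /csem_dec[le ->].
  by exists v, w0, k, (n - r), (z + s); split=> //; split; lia.
- move=> [x0 ->] [_ [v] [w0] [k] [n] [z] [-> rv xE [vi zE]]]; split=> //.
  move: x0; rewrite xE !ffunE eqxx => n0.
  by exists v, w0, k, n, z; split=> //; split; lia.
- move=> S [_ [v] [w0] [k] [n] [z] [-> rv xE [vi zE]]]; split=> //.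
  move: S; rewrite xE => /csem_inc[le ->].
  by exists v, w0, k, (n + 1), (z - 1); split=> //; split; lia.
- move=> [x0 ->] [_ [v] [w0] [k] [n] [z] [-> rv xE [vi zE]]].
  move: x0; rewrite xE !ffunE => z0; exists (upd v i n); first by rewrite z0.
  apply: star_r rv _; apply: MStep tin _; exists k; split=> //.
  by rewrite -zE z0 addn0.
Qed.

Lemma gadget_run c c' : mstep (@asem I) tr c c' ->
  star (mstep (@csem _) gtrans) (inl c.1.1, ext c.1.2 0, c.2)
                                (inl c'.1.1, ext c'.1.2 0, c'.2).
Proof.
case=> {c c'} q o [i [[[d r] e] s]] q' v _ w tin [k [vi ->]] /=.
set t := (q, o, (i, (d, r, e, s)), q') in tin.
have: all (mem gtrans) (gadget t).
  by apply/allP=> x xin; apply/flatten_mapP; exists t.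
rewrite /= => /and5P[g1 g2 g3 g4 /and3P[g5 g6 _]].
have s1 : star (mstep (@csem _) gtrans) (inl q, ext v 0, w)
       (inr (t, 0), ext (upd v i (d * k + r)) 0, w ++ o).
  apply: rt_step; apply: MStep g1 _.
  by apply/csem_zero; rewrite -vi upd_id.
(* The loop is stopped after exactly [k] rounds, when [r] is left in register [i]. *)
have loop1 j : j <= k -> star (mstep (@csem _) gtrans)
     (inr (t, 0), ext (upd v i (d * k + r)) 0, w ++ o)
     (inr (t, 0), ext (upd v i (d * (k - j) + r)) (e * j), w ++ o).
  elim: j => [|j IH] jk; first by rewrite subn0 muln0; apply: rt_refl.
  apply: star_r (IH (ltnW jk)) _.
  apply: mstep0 g2 _. apply/csem_dec.
  have -> : k - j = (k - j.+1).+1 by lia.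
  rewrite !mulnS.
  split; first by rewrite -addnA leq_addr.
  by rewrite -addnA addKn [e + _]addnC.
apply: rt_trans s1 _; apply: rt_trans (loop1 k (leqnn k)) _.
rewrite subnn muln0 add0n.
apply: star_l (_ : mstep _ _ _ (inr (t, 1), ext (upd v i 0) (e * k + s), w ++ o)) _.
  apply: mstep0 g3 _. apply/csem_dec.
  by rewrite subnn.
apply: star_l (_ : mstep _ _ _ (inr (t, 2), ext (upd v i 0) (e * k + s), w ++ o)) _.
  apply: mstep0 g4 _.
  by split; rewrite // !ffunE eqxx.
have loop2 m j : star (mstep (@csem _) gtrans)
     (inr (t, 2), ext (upd v i j) m, w ++ o)
     (inr (t, 2), ext (upd v i (j + m)) 0, w ++ o).
  elim: m j => [|m IH] j; first by rewrite addn0; apply: rt_refl.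
  apply: star_l _ (_ : star _ (_, ext (upd v i (j + 1)) m, _) _); last first.
    by rewrite -[m.+1]add1n addnA; apply: IH.
  apply: mstep0 g5 _. apply/csem_inc.
  by rewrite subn1.
apply: star_r (loop2 _ _) _.
apply: mstep0 g6 _.
by split; rewrite // !ffunE.
Qed.

Lemma gtrans_lang w :
  mlang (@asem I) tr q0 qf (zero I) w <->
  mlang (@csem _) gtrans (inl q0) (inl qf) (zero _) w.
Proof.
have Z : zero (option I) = ext (zero I) 0.
  by apply/ffunP=> -[j|]; rewrite !ffunE.
rewrite /mlang Z; split=> [H|H].
  exact: (star_sim (f := fun c => (inl c.1.1 : gstate, ext c.1.2 0, c.2)) gadget_run H).
have: ginv (inl qf, ext (zero I) 0, w).
  by apply: (star_inv ginv_step H); exists (zero I) => //; apply: rt_refl.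
by case=> v /ext_inj[<- _].
Qed.

End AffineToCounter.

Lemma counter_of_affine (I : finType) L : affine_lang I L -> counter_lang (option I) L.
Proof.
move=> [Q [tr [q0 [qf H]]]]; exists (gstate I Q), (gtrans tr), (inl q0), (inl qf).
by move=> w; rewrite H; apply: gtrans_lang.
Qed.

(** * Several counters in one number, by prime exponents *)

Section CounterToAffine.
Variables (I : finType) (p : I -> nat).
Hypotheses (p_prime : forall i, prime (p i)) (p_inj : injective p).

Definition goedel (v : regs I) := \prod_i p i ^ v i.

Lemma goedel_gt0 v : 0 < goedel v.
Proof. by apply: prodn_gt0 => i; rewrite expn_gt0 prime_gt0. Qed.

(** The factors with index other than [i] are powers of other primes, hence coprime to [p i]. *)
Lemma logn_goedel v i : logn (p i) (goedel v) = v i.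
Proof.
have gt0 (P : pred I) : 0 < \prod_(j | P j) p j ^ v j.
  by apply: prodn_gt0 => j; rewrite expn_gt0 prime_gt0.
rewrite /goedel (bigD1 i) //= lognM ?gt0 ?expn_gt0 ?prime_gt0 //.
rewrite pfactorK // logn_coprime ?addn0 //.
elim/big_ind: _ => [|x y cx cy|j ji]; [exact: coprimen1 | by rewrite coprimeMr cx |].
by rewrite coprimeXr // prime_coprime // dvdn_prime2 // (inj_eq p_inj) eq_sym.
Qed.

Lemma goedel_inj : injective goedel.
Proof. by move=> u v E; apply/ffunP=> i; rewrite -!logn_goedel E. Qed.

Lemma goedelD (a b : regs I) : goedel [ffun i => a i + b i] = goedel a * goedel b.
Proof. by rewrite -big_split; apply: eq_bigr => i _; rewrite ffunE expnD. Qed.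

Lemma goedel_dvd a v : goedel a %| goedel v -> forall i, a i <= v i.
Proof.
by move=> av i; rewrite -!logn_goedel; apply: dvdn_leq_log => //; apply: goedel_gt0.
Qed.

Lemma goedel_sub (a v : regs I) : (forall i, a i <= v i) ->
  goedel v = goedel a * goedel [ffun i => v i - a i].
Proof.
move=> av; rewrite -goedelD; congr goedel.
by apply/ffunP=> i; rewrite !ffunE subnKC.
Qed.

Lemma dvd_goedel v i : (p i %| goedel v) = (0 < v i).
Proof.
by rewrite -[in RHS](logn_goedel v i) logn_gt0 mem_primes p_prime goedel_gt0.
Qed.

Lemma goedel0 : goedel (zero I) = 1.
Proof. by rewrite /goedel big1 // => i _; rewrite ffunE. Qed.

Definition cst n : regs unit := [ffun => n].

Lemma upd_cst n m : upd (cst n) tt m = cst m.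
Proof. by apply/ffunP=> -[]; rewrite !ffunE. Qed.

Variables (Q : countType) (tr : seq (Q * seq T * counter I * Q)) (q0 qf : Q).

(* A counter vector [v] is held as the number [goedel v]; [inr false] and [inr true]
   are a new initial and a new final state, exchanging [0] and [goedel 0 = 1]. *)
Definition pstate : countType := (Q + bool)%type.

(** Subtracting [a] and adding [b] divides by [goedel a] and multiplies by [goedel b]. A counter is
    zero iff its prime does not divide the number, so a zero test is one identity replacement for
    each nonzero remainder. *)
Definition ptrans1 (t : Q * seq T * counter I * Q) :
    seq (pstate * seq T * affine unit * pstate) :=
  let: (q, o, c, q') := t in
  match c with
  | inl (a, b) => [:: (inl q, o, (tt, (goedel a, 0, goedel b, 0)), inl q')]
  | inr i => [seq (inl q, o, (tt, (p i, r, p i, r)), inl q') | r <- iota 1 (p i).-1]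
  end.

Definition ptrans : seq (pstate * seq T * affine unit * pstate) :=
  [:: (inr false, [::], (tt, (1, 0, 1, 1)), inl q0),
      (inl qf, [::], (tt, (1, 1, 1, 0)), inr true) & flatten [seq ptrans1 t | t <- tr]].

Let reach := star (mstep (@csem I) tr) (q0, zero I, [::]).

(** The last move can be made with any [v]; only the acceptance condition, contents 0, forces
    [goedel v = 1] and so [v = 0]. *)
Definition pinv (c : pstate * regs unit * seq T) : Prop :=
  let: (g, x, w) := c in
  match g with
  | inl q => exists2 v, x = cst (goedel v) & reach (q, v, w)
  | inr false => x = cst 0 /\ w = [::]
  | inr true => exists2 v, x = cst (goedel v).-1 & reach (qf, v, w)
  end.

Lemma pinv_step c c' : pinv c -> mstep (@asem _) ptrans c c' -> pinv c'.
Proof.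
move=> H S; case: S H => {c c'} g o c g' x x' w; rewrite !inE.
case/or3P; [case/eqP=> -> -> -> -> |case/eqP=> -> -> -> -> |]; rewrite ?cats0.
- move=> [k [xk ->]] [x0 ->]; move: xk; rewrite x0 ffunE upd_cst => /eqP.
  rewrite eq_sym addn_eq0 mul1n => /andP[/eqP-> _].
  by exists (zero I); [rewrite goedel0 | apply: rt_refl].
- move=> [k [xk ->]] [v xE rv]; exists v => //.
  by rewrite xE upd_cst; move: xk; rewrite xE ffunE => ->; rewrite !mul1n !addn1 addn0.
case/flatten_mapP=> -[[[q o'] [[a b]|i]] q'] tin.
- rewrite /= inE => /eqP[-> -> -> ->] [k [xk ->]] [v xE rv].
  move: xk; rewrite xE ffunE addn0 => vE.
  have le : forall i, a i <= v i by apply: goedel_dvd; rewrite vE dvdn_mulr.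
  have kE : k = goedel [ffun i => v i - a i].
    apply/eqP; rewrite -(eqn_pmul2l (goedel_gt0 a)) -goedel_sub //; exact/eqP.
  exists [ffun i => v i - a i + b i].
    rewrite upd_cst addn0 kE mulnC -goedelD; congr (cst (goedel _)).
    by apply/ffunP=> i; rewrite !ffunE.
  by apply: star_r rv _; apply: MStep tin _.
- case/mapP=> r; rewrite mem_iota => rlt [-> -> -> ->] [k [xk ->]] [v xE rv].
  move: xk; rewrite xE ffunE => vE; exists v; first by rewrite upd_cst -vE.
  apply: star_r rv _; apply: MStep tin _; split=> //.
  (* The remainder [r] lies strictly between 0 and [p i], so [p i] does not divide the number. *)
  apply/eqP; rewrite -[_ == 0]negbK -lt0n -dvd_goedel vE dvdn_addr ?dvdn_mulr //.
  by rewrite gtnNdvd //; move: rlt (prime_gt0 (p_prime i)); lia.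
Qed.

Lemma ptrans_run c c' : mstep (@csem I) tr c c' ->
  star (mstep (@asem _) ptrans) (inl c.1.1, cst (goedel c.1.2), c.2)
                                (inl c'.1.1, cst (goedel c'.1.2), c'.2).
Proof.
case=> {c c'} q o [[a b]|i] q' v v' w tin.
- move=> [le ->] /=; apply: rt_step; apply: MStep.
    by rewrite !inE; apply/or3P/Or33/flatten_mapP; eexists; [exact: tin | rewrite inE].
  exists (goedel [ffun i => v i - a i]).
  rewrite !addn0 upd_cst ffunE -goedel_sub // -goedelD; split=> //.
  by congr (cst (goedel _)); apply/ffunP=> i; rewrite !ffunE addnC.
- move=> [v0 ->] /=; apply: rt_step; apply: MStep.
    rewrite !inE; apply/or3P/Or33/flatten_mapP; exists (q, o, inr i, q') => //=.
    apply/mapP; exists (goedel v %% p i); last by [].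
    rewrite mem_iota add1n (prednK (prime_gt0 (p_prime i))) ltn_mod (prime_gt0 (p_prime i)) andbT.
    by rewrite lt0n -/(p i %| goedel v) dvd_goedel v0.
  exists (goedel v %/ p i); rewrite upd_cst ffunE [p i * _]mulnC.
  by rewrite -divn_eq.
Qed.

Lemma ptrans_lang w :
  mlang (@csem I) tr q0 qf (zero I) w <->
  mlang (@asem _) ptrans (inr false) (inr true) (zero _) w.
Proof.
have Z : zero unit = cst 0 by [].
rewrite /mlang Z; split=> [H|H].
  apply: star_l (_ : mstep _ _ _ (inl q0, cst (goedel (zero I)), [::])) _.
    apply: (mstep0 (p := (tt, (1, 0, 1, 1)) : affine unit)); first by rewrite inE eqxx.
    by exists 0; rewrite upd_cst goedel0 ffunE.
  apply: star_r (_ : star _ _ (inl qf, cst (goedel (zero I)), w)) _.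
    exact: (star_sim (f := fun c => (inl c.1.1 : pstate, cst (goedel c.1.2), c.2))
      ptrans_run H).
  apply: (mstep0 (p := (tt, (1, 1, 1, 0)) : affine unit)).
    by rewrite !inE eqxx orbT.
  by exists 0; rewrite upd_cst goedel0 ffunE.
have: pinv (inr true, cst 0, w) by apply: (star_inv pinv_step H).
case=> v /ffunP/(_ tt); rewrite !ffunE => v1.
suff -> : v = zero I by [].
by apply: goedel_inj; rewrite goedel0; move: v1 (goedel_gt0 v); lia.
Qed.

End CounterToAffine.

Lemma affine_of_counter (I : finType) (p : I -> nat) L :
  (forall i, prime (p i)) -> injective p -> counter_lang I L -> affine_lang unit L.
Proof.
move=> pp ip [Q [tr [q0 [qf H]]]].
exists (pstate Q), (ptrans p tr q0 qf), (inr false), (inr true).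
by move=> w; rewrite H; apply: ptrans_lang.
Qed.

End Machines.

(** * Backward derivations on two stacks held as numbers *)

Section GrammarToAffine.
Variables (T : finType) (n : nat) (G : ps_grammar T n).

Local Notation sym := (T + 'I_n)%type.
Local Notation derives := (clos_refl_trans _ (@ps_step T n G)).

Definition base := #|{: sym}|.+1.
Definition digit (a : sym) := (enum_rank a).+1.

(* Words are numbers written with the nonzero digits in base [base], so that leading
   zeros cannot make two words collide. *)
Definition num (u : seq sym) := foldl (fun k a => base * k + digit a) 0 u.

Lemma digit_lt a : digit a < base. Proof. exact: ltn_ord. Qed.

Lemma digit_inj a b : digit a = digit b -> a = b.
Proof. by case=> /ord_inj/enum_rank_inj. Qed.

Lemma num_rcons u a : num (rcons u a) = base * num u + digit a.
Proof. by rewrite /num -cats1 foldl_cat. Qed.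

Lemma num_cat u r : num (u ++ r) = base ^ size r * num u + num r.
Proof.
elim/last_ind: r => [|r a IH]; first by rewrite cats0 expn0 mul1n addn0.
by rewrite -rcons_cat !num_rcons IH size_rcons expnS mulnDr mulnA addnA.
Qed.

(** Reduction modulo [base] recovers the last letter, since digits are below [base]; as digits are
    nonzero, [u] cannot run out before [r] does. *)
Lemma num_split r u k : num u = base ^ size r * k + num r ->
  exists2 u', u = u' ++ r & k = num u'.
Proof.
elim/last_ind: r u => [|r a IH] u.
  by rewrite expn0 mul1n addn0 => <-; exists u; rewrite ?cats0.
rewrite num_rcons size_rcons expnS -mulnA addnA -mulnDr.
case/lastP: u => [|u b]; first by rewrite addnS.
rewrite num_rcons => E; have ab : b = a.
  apply: digit_inj; move/(congr1 (modn^~ base)): E.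
  by rewrite ![base * _]mulnC !modnMDl !modn_small ?digit_lt.
move/eqP: E; rewrite ab eqn_add2r eqn_pmul2l // => /eqP/IH[u' -> ->].
by exists u'; rewrite ?rcons_cat.
Qed.

Lemma num_eq0 u : num u = 0 -> u = [::].
Proof. by case/lastP: u => // u a; rewrite num_rcons addnS. Qed.

(** Stack [false] holds the word left of the cut, stack [true] the reversal of the word right of it,
    so that both tops, the lowest digits, are at the cut. *)
Definition stacks x y : regs bool := [ffun b => if b then y else x].

Lemma upd_stacks x y b z : upd (stacks x y) b z = if b then stacks x z else stacks z y.
Proof. by case: b; apply/ffunP=> -[]; rewrite !ffunE. Qed.

Definition sstate : countType := (nat + (sym + sym))%type.

(** The intermediate state remembers the letter that has left one stack and is not yet on the
    other. *)
Definition move_ops (a : sym) : seq (sstate * seq T * affine bool * sstate) :=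
  [:: (inl 1, [::], (false, (base, digit a, 1, 0)), inr (inl a));
      (inr (inl a), [::], (true, (1, 0, base, digit a)), inl 1);
      (inl 1, [::], (true, (base, digit a, 1, 0)), inr (inr a));
      (inr (inr a), [::], (false, (1, 0, base, digit a)), inl 1)].

(* In state 0 a terminal word is written and pushed on stack [false]; in state 1 a
   derivation is run backwards on the word cut between the two stacks; state 2 accepts. *)
Definition strans : seq (sstate * seq T * affine bool * sstate) :=
  [:: (inl 0, [::], (false, (1, 0, 1, 0)), inl 1),
      (inl 1, [::], (false, (0, num [:: inr (ps_start G)], 0, 0)), inl 2) &
   [seq (inl 0, [:: t], (false, (1, 0, base, digit (inl t))), inl 0) | t <- enum T] ++
   [seq (inl 1, [::], (false, (base ^ size p.2, num p.2, base ^ size p.1, num p.1)),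
         inl 1) | p <- ps_prods G] ++
   flatten [seq move_ops a | a <- enum {: sym}]].

(** The word around the cut, with a letter in transit put back between the stacks, derives the
    written word. In state 2 the start symbol has been removed from the left stack and is put back
    in front. *)
Definition sinv (c : sstate * regs bool * seq T) : Prop :=
  let: (q, x, w) := c in
  let split u0 := exists u z,
    x = stacks (num u) (num (rev z)) /\ derives (u ++ u0 ++ z) (map inl w) in
  match q with
  | inl 0 => x = stacks (num (map inl w)) 0
  | inl 1 => split [::]
  | inl _ => exists2 z,
      x = stacks 0 (num (rev z)) & derives (inr (ps_start G) :: z) (map inl w)
  | inr (inl a) | inr (inr a) => split [:: a]
  end.

Lemma sinv_step c c' : sinv c -> mstep (@asem _) strans c c' -> sinv c'.
Proof.
move=> H S; case: S H => {c c'} q o p q' x x' w; rewrite !inE !mem_cat.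
case/or3P=> [/eqP[-> -> -> ->] | /eqP[-> -> -> ->] | /or3P[]].
- move=> [k [xk ->]] xE; rewrite cats0; exists (map inl w), [::].
  rewrite !cats0; split; last exact: rt_refl.
  by move: xk; rewrite xE ffunE mul1n addn0 => <-; rewrite upd_stacks.
- move=> [k [xk ->]] [u [z [xE uz]]]; rewrite cats0.
  move: xk; rewrite xE ffunE mul0n add0n => uE.
  (* With [d = 0] the left stack equals the code of the start symbol; the quotient 0 shows that
     nothing lies below it. *)
  have: num u = base ^ size [:: inr (ps_start G) : sym] * 0 + num [:: inr (ps_start G)].
    by rewrite muln0.
  case/num_split=> u' E /esym/num_eq0 u0.
  exists z; first by rewrite upd_stacks.
  by move: uz; rewrite E u0.
- case/mapP=> t _ [-> -> -> ->] [k [xk ->]] xE /=.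
  move: xk; rewrite xE ffunE mul1n addn0 => <-.
  by rewrite upd_stacks -num_rcons cats1 map_rcons.
- case/mapP=> -[l r] pin [-> -> -> ->] [k [xk ->]] [u [z [xE uz]]]; rewrite cats0.
  move: xk; rewrite xE ffunE => /num_split[u' uE ->].
  rewrite upd_stacks -num_cat; exists (u' ++ l), z; split=> //.
  apply: star_l uz; exists l, r, u', z; split; first exact/In_mem.
  by rewrite uE /= !catA.
case/flatten_mapP=> a _; rewrite !inE; case/or4P=> /eqP[-> -> -> ->] [k [xk ->]].
- move=> [u [z [xE uz]]]; move: xk; rewrite xE ffunE cats0.
  have -> : base * k + digit a = base ^ size [:: a] * k + num [:: a].
    by rewrite expn1 /num /= muln0.
  case/num_split=> u' uE ->; exists u', z.
  by rewrite upd_stacks mul1n addn0; split=> //; rewrite catA -uE.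
- move=> [u [z [xE uz]]]; move: xk; rewrite xE ffunE cats0 mul1n addn0 => <-.
  by exists u, (a :: z); rewrite upd_stacks rev_cons num_rcons.
- move=> [u [z [xE uz]]]; move: xk; rewrite xE ffunE cats0.
  have -> : base * k + digit a = base ^ size [:: a] * k + num [:: a].
    by rewrite expn1 /num /= muln0.
  case/num_split=> z' zE ->; exists u, (rev z').
  rewrite upd_stacks mul1n addn0 revK; split=> //.
  suff E : z = a :: rev z' by move: uz; rewrite E.
  by rewrite -[z]revK zE cats1 rev_rcons.
- move=> [u [z [xE uz]]]; move: xk; rewrite xE ffunE cats0 mul1n addn0 => <-.
  by exists (rcons u a), z; rewrite upd_stacks num_rcons /= cat_rcons.
Qed.

Local Notation run := (star (mstep (@asem _) strans)).

Lemma stack_move q q' b d r e s x y z (w : seq T) k :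
  (q, [::], (b, (d, r, e, s)), q') \in strans ->
  (if b then y else x) = d * k + r -> z = e * k + s ->
  mstep (@asem _) strans (q, stacks x y, w)
    (q', if b then stacks x z else stacks z y, w).
Proof.
move=> tin xE zE; apply: mstep0 tin _; exists k.
by rewrite ffunE xE zE upd_stacks.
Qed.

Lemma move_opsP a t : t \in move_ops a -> t \in strans.
Proof.
move=> ta; rewrite !inE !mem_cat; apply/orP; right; apply/orP; right.
apply/orP; right; apply/orP; right; apply/flatten_mapP; exists a => //.
by rewrite mem_enum.
Qed.

Let affine_id k : k = 1 * k + 0. Proof. by rewrite mul1n addn0. Qed.

Lemma move_right u a z w :
  run (inl 1, stacks (num (rcons u a)) (num (rev z)), w)
      (inl 1, stacks (num u) (num (rev (a :: z))), w).
Proof.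
have /allP := @move_opsP a; rewrite /= => /and5P[t1 t2 _ _ _].
apply: star_l (stack_move w t1 (num_rcons u a) (affine_id _)) _.
apply: star_l (stack_move w t2 (affine_id _) (erefl _)) _ => /=.
by rewrite rev_cons num_rcons; apply: rt_refl.
Qed.

Lemma move_left u a z w :
  run (inl 1, stacks (num u) (num (rev (a :: z))), w)
      (inl 1, stacks (num (rcons u a)) (num (rev z)), w).
Proof.
have /allP := @move_opsP a; rewrite /= => /and5P[_ _ t3 t4 _].
rewrite rev_cons.
apply: star_l (stack_move w t3 (num_rcons (rev z) a) (affine_id _)) _.
apply: star_l (stack_move w t4 (affine_id _) (erefl _)) _ => /=.
by rewrite num_rcons; apply: rt_refl.
Qed.

Definition cut (u z : seq sym) w : sstate * regs bool * seq T :=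
  (inl 1, stacks (num u) (num (rev z)), w).

Lemma cut_left u z w : run (cut u z w) (cut [::] (u ++ z) w) /\
  run (cut [::] (u ++ z) w) (cut u z w).
Proof.
elim/last_ind: u z => [|u a IH] z; first by split; apply: rt_refl.
rewrite cat_rcons; have [IH1 IH2] := IH (a :: z); split.
  by apply: rt_trans IH1; apply: move_right.
by apply: rt_trans IH2 _; apply: move_left.
Qed.

Lemma cut_any u z u' z' w : u ++ z = u' ++ z' -> run (cut u z w) (cut u' z' w).
Proof.
move=> E; have [H _] := cut_left u z w; apply: rt_trans H _; rewrite E.
by have [] := cut_left u' z' w.
Qed.

(** A step is undone by moving the cut to the end of the right-hand side, replacing it on top of the
    left stack by the left-hand side, and moving the cut back. *)
Lemma derives_run x y w : derives x y -> run (cut [::] y w) (cut [::] x w).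
Proof.
elim=> {x y} [x y|x|x y z _ IH1 _ IH2]; [|exact: rt_refl|exact: rt_trans IH2 IH1].
move=> [l [r [u [v [/In_mem pin [-> ->]]]]]].
rewrite catA; apply: rt_trans (cut_any w (u' := u ++ r) (z' := v) _) _; first by [].
apply: rt_trans (_ : run _ (cut (u ++ l) v w)) _; last first.
  by apply: cut_any; rewrite -catA.
apply: rt_step; rewrite /cut !num_cat.
apply: (stack_move w (b := false)); [|exact: erefl|exact: erefl].
rewrite !inE !mem_cat; apply/orP; right; apply/orP; right; apply/orP; right.
by apply/orP; left; apply/mapP; exists (l, r).
Qed.

Lemma write_run w : run (inl 0, stacks 0 0, [::]) (inl 0, stacks (num (map inl w)) 0, w).
Proof.
elim/last_ind: w => [|w t IH]; first exact: rt_refl.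
apply: star_r IH _; rewrite map_rcons num_rcons -cats1.
apply: (MStep (p := (false, (1, 0, base, digit (inl t))) : affine bool)); last first.
  exists (num (map inl w)); split; first by rewrite ffunE mul1n addn0.
  by rewrite upd_stacks.
rewrite !inE !mem_cat; apply/orP; right; apply/orP; right; apply/orP; left.
by apply/mapP; exists t; rewrite // mem_enum.
Qed.

Lemma strans_lang w : ps_language G w <->
  mlang (@asem _) strans (inl 0) (inl 2) (zero bool) w.
Proof.
have Z : zero bool = stacks 0 0 by apply/ffunP=> -[]; rewrite !ffunE.
rewrite /mlang Z; split=> [H|H]; last first.
  have: sinv (inl 2, stacks 0 0, w) by apply: (star_inv sinv_step H).
  case=> z /ffunP/(_ true); rewrite !ffunE => /esym/num_eq0.
  by case: z => // a z; rewrite rev_cons; case: (rev z).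
apply: rt_trans (write_run w) _.
apply: star_l (_ : mstep _ _ _ (cut (map inl w) [::] w)) _.
  apply: (stack_move w (b := false) (d := 1) (r := 0) (e := 1) (s := 0)).
  - by rewrite inE eqxx.
  - by rewrite mul1n addn0.
  - by rewrite mul1n addn0.
apply: rt_trans (cut_any w (u' := [::]) (z' := map inl w) _) _; first by rewrite cats0.
apply: rt_trans (derives_run w H) _.
apply: rt_trans (cut_any w (u' := [:: inr (ps_start G)]) (z' := [::]) _) _; first by [].
apply: rt_step; rewrite /cut.
apply: (stack_move w (b := false) (d := 0) (r := num [:: inr (ps_start G)])
  (e := 0) (s := 0) (z := 0) (k := 0)) => //.
by rewrite !inE eqxx orbT.
Qed.

End GrammarToAffine.

Lemma affine_of_RE (T : finType) (L : seq T -> Prop) : RE L -> affine_lang bool L.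
Proof.
move=> [n [G [_ H]]]; exists (sstate T n), (strans G), (inl 0), (inl 2).
by move=> w; rewrite H; apply: strans_lang.
Qed.

(** Two stacks give three counters, these give one affine register through the primes 2, 3, 5, and
    that register gives two counters. *)
Lemma counter_of_RE (T : finType) (L : seq T -> Prop) :
  RE L -> counter_lang (option unit) L.
Proof.
move/affine_of_RE/counter_of_affine.
pose p (o : option bool) := match o with None => 2 | Some false => 3 | _ => 5 end.
by move/(@affine_of_counter _ _ p)=> H; apply/counter_of_affine/H; case=> [[]|] // [[]|].
Qed.

(** * Matrices acting on a word that ends in a block of one nonterminal *)

Section ApplyRules.
Variables (T N : eqType).
Local Notation sym := (T + N)%type.
Implicit Types (x y z u v : seq sym) (a c : N) (rs : seq (N * seq sym)).

Lemma apply_rules_cat rs1 rs2 x y :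
  apply_rules (rs1 ++ rs2) x y <->
  exists2 z, apply_rules rs1 x z & apply_rules rs2 z y.
Proof.
elim: rs1 x => [|[a w] rs1 IH] x /=; split.
- by move=> H; exists x => //; constructor.
- by case=> z H; inversion H.
- move=> H; inversion H as [|A w' rs x' z y' r1 r2]; subst.
  have [z' H1 H2] := (IH z).1 r2; exists z' => //; exact: apply_cons r1 H1.
- case=> z H H2; inversion H as [|A w' rs x' z' y' r1 r2]; subst.
  by apply: apply_cons r1 _; apply/IH; exists z.
Qed.

Lemma cat_nseq_cons c m a u v : nseq m (inr c : sym) = u ++ inr a :: v ->
  [/\ a = c, m = (size u + size v).+1, u = nseq (size u) (inr c)
    & v = nseq (size v) (inr c)].
Proof.
move=> E; have: all (pred1 (inr c : sym)) (nseq m (inr c)) by apply: all_pred1_nseq.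
rewrite E all_cat /= => /and3P[/all_pred1P uE /eqP[ac] /all_pred1P vE]; split=> //.
by rewrite -(size_nseq m (inr c : sym)) E size_cat /= addnS.
Qed.

Lemma cat_split_cons c m a y u v : y ++ nseq m (inr c) = u ++ inr a :: v ->
  (exists2 y2, y = u ++ inr a :: y2 & v = y2 ++ nseq m (inr c)) \/
  a = c /\ exists j k, [/\ m = (j + k).+1, u = y ++ nseq j (inr c) & v = nseq k (inr c)].
Proof.
elim: y u => [|b y IH] [|d u] //=.
- move/(@cat_nseq_cons c m a [::] v)=> [-> mE _ vE]; right; split=> //.
  by exists 0, (size v).
- move/(@cat_nseq_cons c m a (d :: u) v)=> [-> mE uE vE]; right; split=> //.
  by exists (size (d :: u)), (size v).
- by case=> -> <-; left; exists y.
- by case=> <- /IH[[y2 -> ->]|[-> [j [k [-> -> ->]]]]]; [left; exists y2 | right; split=> //; exists j, k].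
Qed.

Definition terminals y : seq T := pmap (fun s => if s is inl t then Some t else None) y.

Lemma terminals_cat x y : terminals (x ++ y) = terminals x ++ terminals y.
Proof. exact: pmap_cat. Qed.

Lemma terminals_inl w : terminals (map inl w) = w.
Proof. by elim: w => //= t w ->. Qed.

Lemma terminals_nseq k a : terminals (nseq k (inr a)) = [::].
Proof. by elim: k. Qed.

Definition occ a y := count_mem (inr a) y.

Lemma occ_cat a x y : occ a (x ++ y) = occ a x + occ a y.
Proof. exact: count_cat. Qed.

Lemma occ_nseq a b k : occ a (nseq k (inr b)) = (b == a) * k.
Proof. by rewrite /occ count_nseq. Qed.

Lemma occ_inl a w : occ a (map inl w) = 0.
Proof. by elim: w. Qed.

Lemma occ_delete a b y1 y2 : occ a (y1 ++ inr b :: y2) = (b == a) + occ a (y1 ++ y2).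
Proof. by rewrite !occ_cat /= /occ /= addnCA. Qed.

Lemma rewrite1_tail c m y w z : occ c y = 0 ->
  rewrite1 c w (y ++ nseq m (inr c)) z ->
  exists j k, m = (j + k).+1 /\ z = y ++ nseq j (inr c) ++ w ++ nseq k (inr c).
Proof.
move=> y0 [u [v [/cat_split_cons[[y2 yE]|[_ [j [k [-> -> ->]]]]] ->]]].
  by move: y0; rewrite yE occ_delete eqxx.
by exists j, k; rewrite -catA.
Qed.

Definition erasing (s : seq N) : seq (N * seq sym) := [seq (a, [::]) | a <- s].

Lemma erase_tail c k m y z : occ c y = 0 ->
  apply_rules (erasing (nseq k c)) (y ++ nseq m (inr c)) z ->
  k <= m /\ z = y ++ nseq (m - k) (inr c).
Proof.
move=> y0; elim: k m => [|k IH] m H; inversion H as [|A w' rs x' z' y' r1 r2]; subst.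
  by rewrite subn0.
have [i [j [mE zE]]] := rewrite1_tail y0 r1.
move: r2; rewrite zE /= -nseqD => /IH[le ->]; rewrite mE; split=> //.
Qed.

Lemma erase_tail_run c k m y :
  apply_rules (erasing (nseq k c)) (y ++ nseq (k + m) (inr c)) (y ++ nseq m (inr c)).
Proof.
elim: k => [|k IH]; first exact: apply_nil.
apply: apply_cons IH; exists y, (nseq (k + m) (inr c)); by [].
Qed.

(** Letters other than [c] can only be erased before the block. Which occurrences are chosen does
    not matter: only the terminals in order and the numbers of nonterminals are recorded. *)
Lemma erase_head c s m y z : c \notin s ->
  apply_rules (erasing s) (y ++ nseq m (inr c)) z ->
  exists y', [/\ z = y' ++ nseq m (inr c), terminals y' = terminals y &
    forall a, occ a y = count_mem a s + occ a y'].
Proof.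
elim: s y => [|a s IH] y cs H; inversion H as [|A w' rs x' z' y' r1 r2]; subst.
  by exists y.
move: cs; rewrite inE negb_or => /andP[ca cs].
case: r1 => u [v [/cat_split_cons[[y2 yE vE]|[ac]]]]; last by rewrite ac eqxx in ca.
move=> zE; move: r2; rewrite zE vE /= catA => /(IH _ cs)[y' [-> y't y'n]]; exists y'.
split=> //; first by rewrite y't yE !terminals_cat.
by move=> b; rewrite yE occ_delete y'n /= addnA.
Qed.

Lemma erase_head_run s y t : (forall a, count_mem a s <= occ a y) ->
  exists y', [/\ apply_rules (erasing s) (y ++ t) (y' ++ t),
    terminals y' = terminals y & forall a, occ a y = count_mem a s + occ a y'].
Proof.
elim: s y => [|a s IH] y le; first by exists y; split=> //; apply: apply_nil.
have: has (pred1 (inr a : sym)) y.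
  by rewrite has_count; apply: leq_trans (le a); rewrite /= eqxx.
rewrite has_pred1 => /path.splitPr yE; case: yE le => y1 y2 le.
case: (IH (y1 ++ y2)) => [b|y' [r y't y'n]].
  by move: (le b); rewrite occ_delete /= leq_add2l.
exists y'; split; last by move=> b; rewrite occ_delete y'n /= addnA.
  apply: apply_cons r; exists y1, (y2 ++ t).
  by rewrite -!catA.
by rewrite y't !terminals_cat.
Qed.

Lemma factor_nseq c k m y : occ c y = 0 ->
  factor (nseq k (inr c)) (y ++ nseq m (inr c)) <-> k <= m.
Proof.
move=> y0; split=> [[u [v E]]|km].
  move/(congr1 (occ c)): E; rewrite !occ_cat y0 !occ_nseq eqxx !mul1n add0n => ->.
  by rewrite addnCA leq_addr.
by exists (y ++ nseq (m - k) (inr c)), [::]; rewrite cats0 -catA -nseqD subnK.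
Qed.

Lemma factor_single a y : factor [:: inr a] y <-> 0 < occ a y.
Proof.
split=> [[u [v ->]]|]; first by rewrite occ_delete eqxx.
rewrite -has_count has_pred1 => /path.splitPr[y1 y2].
by exists y1, y2.
Qed.

(* On words ending in a block of [c] it applies only if that block has length exactly [k]. *)
Definition exact_rules c k (s : seq N) out : seq (N * seq sym) :=
  erasing s ++ erasing (nseq k.-1 c) ++ [:: (c, out)].

(** The forbidden string gives [m <= k], and consuming [k] letters [c] gives [k <= m]. The last rule
    then rewrites the only [c] left, so [out] ends the word. *)
Lemma exact_sound c k s out m y z :
  0 < k -> c \notin s -> occ c y = 0 ->
  ~ factor (nseq k.+1 (inr c)) (y ++ nseq m (inr c)) ->
  apply_rules (exact_rules c k s out) (y ++ nseq m (inr c)) z ->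
  m = k /\ exists y', [/\ z = y' ++ out, terminals y' = terminals y &
    forall a, occ a y = count_mem a s + occ a y'].
Proof.
move=> k0 cs y0 /factor_nseq nf /apply_rules_cat[z1].
case/(erase_head cs)=> y' [-> y't y'n] /apply_rules_cat[z2].
have y'0 : occ c y' = 0 by move: (y'n c); rewrite y0; lia.
case/(erase_tail y'0)=> le -> H; inversion H as [|A w' rs x' z' y'' r1 r2]; subst.
inversion r2; subst.
have [i [j [mE ->]]] := rewrite1_tail y'0 r1.
have km : m = k by move: nf; move=> /(_ y0); lia.
split=> //; exists y'; split=> //.
have [-> ->] : i = 0 /\ j = 0 by lia.
by rewrite cats0.
Qed.

Lemma exact_run c k s out y :
  0 < k -> (forall a, count_mem a s <= occ a y) ->
  exists y', [/\ apply_rules (exact_rules c k s out) (y ++ nseq k (inr c)) (y' ++ out),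
    terminals y' = terminals y & forall a, occ a y = count_mem a s + occ a y'].
Proof.
move=> k0 /(@erase_head_run s y (nseq k (inr c)))[y' [r y't y'n]]; exists y'; split=> //.
apply/apply_rules_cat; exists (y' ++ nseq k (inr c)) => //.
apply/apply_rules_cat; exists (y' ++ nseq 1 (inr c)).
  by move: (erase_tail_run c k.-1 1 y'); rewrite addn1 prednK.
apply: apply_cons (apply_nil _); exists y', [::]; by rewrite cats0.
Qed.

End ApplyRules.

(** * Two counters in an SCM grammar with three nonterminals *)

Section CounterToSCM.
Variables (T : finType) (Q : countType).
Variables (tr : seq (Q * seq T * counter (option unit) * Q)) (q0 qf : Q).

Local Notation sym := (T + 'I_3)%type.

Definition symA : 'I_3 := @Ordinal 3 0 isT.
Definition symB : 'I_3 := @Ordinal 3 1 isT.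
Definition symC : 'I_3 := @Ordinal 3 2 isT.
Definition rsym (i : option unit) := if i is Some _ then symB else symA.

Definition states : seq Q := q0 :: qf :: [seq t.1.1.1 | t <- tr] ++ [seq t.2 | t <- tr].
(** Codes are positive because every matrix needs a letter C: length 0 is left for the finished
    word. *)
Definition scode (q : Q) := (index q states).+1.
Definition bound := (size states).+1.

(* A zero test of register [i] lengthens the block by [weight i * bound]. The weights are
   chosen so that the length tells which single test was made: two tests add at least [4 * bound]. *)
Definition weight (i : option unit) := if i is Some _ then 3 else 2.

Lemma weightP i : weight i = 2 \/ weight i = 3.
Proof. by case: i => [?|]; [right | left]. Qed.

Lemma weight_inj : injective weight.
Proof. by move=> [[]|] [[]|]. Qed.

Definition regword (b : regs (option unit)) : seq sym :=
  nseq (b None) (inr symA) ++ nseq (b (Some tt)) (inr symB).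

Definition exact_matrix k (s : seq 'I_3) (out : seq sym) :=
  (exact_rules symC k s out, Some (nseq k.+1 (inr symC : sym))).

Definition test_matrix i : seq ('I_3 * seq sym) * option (seq sym) :=
  ([:: (symC, nseq (weight i * bound).+1 (inr symC))], Some [:: inr (rsym i)]).

(** A zero-test transition does not look at the register. It only accepts the block length that a
    preceding [test_matrix i] has produced from state [q]. *)
Definition trans_matrix (t : Q * seq T * counter (option unit) * Q) :=
  let: (q, o, p, q') := t in
  let out := nseq (scode q') (inr symC) in
  match p with
  | inl (a, b) => exact_matrix (scode q) (nseq (a None) symA ++ nseq (a (Some tt)) symB)
                    (map inl o ++ regword b ++ out)
  | inr i => exact_matrix (scode q + weight i * bound) [::] (map inl o ++ out)
  end.

Definition matrices : seq (seq ('I_3 * seq sym) * option (seq sym)) :=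
  undup [:: exact_matrix (scode qf) [::] [::], test_matrix None, test_matrix (Some tt) &
            [seq trans_matrix t | t <- tr]].

Definition to_matrix (m : seq ('I_3 * seq sym) * option (seq sym)) :
  scm_matrix sym 'I_3 := SCMMatrix m.1 None m.2.

Definition counter_scm : scm_grammar T 3 := SCMGrammar symC [seq to_matrix m | m <- matrices].

Lemma mem_matrices m : m \in matrices ->
  [\/ m = exact_matrix (scode qf) [::] [::], exists i, m = test_matrix i |
      exists2 t, t \in tr & m = trans_matrix t].
Proof.
rewrite mem_undup !inE => /or4P[/eqP|/eqP|/eqP|/mapP]; [exact: Or31 | | | exact: Or33].
- by move=> ->; apply: Or32; exists None.
- by move=> ->; apply: Or32; exists (Some tt).
Qed.

Lemma counter_scm_wf : scm_grammar_wf counter_scm.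
Proof.
split; first by apply: NoDup_map_uniq (undup_uniq _) => -[a b] [c d] [/= -> ->].
move=> r /In_map_mem[m min ->]; split; last (split=> //).
- case/mem_matrices: min => [->|[i ->]|[[[[q o] [[a b]|i]] q'] _ ->]] //=;
  by move/(congr1 size); rewrite !size_cat /= !addn1 !addnS.
- by case/mem_matrices: min => [->|[i ->]|[[[[q o] [[a b]|i]] q'] _ ->]].
Qed.

Lemma scode_inj q q1 : q1 \in states -> scode q = scode q1 -> q = q1.
Proof.
move=> q1s /succn_inj E; have qs : q \in states by rewrite -index_mem E index_mem.
by rewrite -(nth_index q0 qs) E nth_index.
Qed.

Lemma scode_le q : 0 < scode q <= bound.
Proof. by apply/andP; split=> //; rewrite /scode /bound ltnS index_size. Qed.

Definition represents (v : regs (option unit)) (w : seq T) (y : seq sym) :=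
  [/\ occ symC y = 0, terminals y = w & forall i, occ (rsym i) y = v i].

Let reach := star (mstep (@csem (option unit)) tr) (q0, zero _, [::]).

(** Blocks longer than [4 * bound] are dead, as no exact matrix has such a length and tests only
    lengthen them. The other cases are the finished word and a live state with at most one
    certificate. *)
Definition block_inv (y : seq sym) (m : nat) : Prop :=
  [\/ 4 * bound < m,
      m = 0 /\ (exists v w, represents v w y /\ reach (qf, v, w)) |
      exists q v w, [/\ represents v w y, reach (q, v, w) &
        m = scode q \/ exists2 i, v i = 0 & m = scode q + weight i * bound]].

Definition word_inv (z : seq sym) : Prop :=
  exists y m, [/\ z = y ++ nseq m (inr symC), occ symC y = 0 & block_inv y m].

Lemma src_states q o p q' : (q, o, p, q') \in tr -> q \in states.
Proof.
move=> tin; rewrite !inE mem_cat; apply/orP; right; apply/orP; right.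
by apply/orP; left; apply/mapP; exists (q, o, p, q').
Qed.

Lemma occ_regword b i : occ (rsym i) (regword b) = b i.
Proof.
by rewrite occ_cat !occ_nseq; case: i => [[]|]; rewrite /= ?mul0n ?mul1n ?addn0.
Qed.

Lemma terminals_regword b : terminals (regword b) = [::].
Proof. by rewrite terminals_cat !terminals_nseq. Qed.

Lemma count_erased (a : regs (option unit)) i :
  count_mem (rsym i) (nseq (a None) symA ++ nseq (a (Some tt)) symB) = a i.
Proof.
by rewrite count_cat !count_nseq; case: i => [[]|]; rewrite /= ?mul0n ?mul1n ?addn0.
Qed.

Lemma word_inv_step x z : word_inv x -> scm_step counter_scm x z -> word_inv z.
Proof.
move=> [y [m [-> y0 inv]]] [r [/In_map_mem[rm min ->] [_ [nf ru]]]].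
have bk := scode_le.
case/mem_matrices: min nf ru => [->|[i ->]|[[[[q o] [[a b]|i]] q'] tin ->]] nf.
- case/(exact_sound (isT : 0 < scode qf) _ y0 (nf _ erefl))=> // mE [y' [-> y't y'n]].
  exists y', 0; split; rewrite ?cats0 //; first exact: etrans (esym (y'n symC)) y0.
  case: inv => [lt|[m0]|[q [v [w [[_ yw yv] rv qm]]]]].
  + by move: (bk qf); lia.
  + by move: (bk qf); lia.
  (* A certificate would make the block longer than [2 * bound], while [scode qf] is at most
     [bound]. *)
  + have qq : scode q = scode qf.
      case: qm => [<-//|[i _ qm]]; move: (bk qf) (bk q) qm; rewrite mE.
      by case: (weightP i) => ->; lia.
    move: rv; rewrite (scode_inj _ qq) ?inE ?eqxx ?orbT // => rv.
    apply: Or32; split=> //; exists v, w; split=> //; split.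
    * exact: etrans (esym (y'n symC)) y0.
    * by rewrite y't.
    * by move=> i; rewrite -yv y'n.
- move: (nf _ erefl) => /factor_single nf0 H.
  have yi : occ (rsym i) y = 0.
    by move: nf0; rewrite occ_cat; lia.
  inversion H as [|A w' rs x' z' y' r1 r2]; subst; inversion r2; subst.
  have [j [k [mE ->]]] := rewrite1_tail y0 r1.
  exists y, (m + weight i * bound); split=> //.
    rewrite -[_ :: _]/(nseq (weight i * bound).+1 _) -!nseqD.
    by congr (_ ++ nseq _ _); rewrite mE; lia.
  case: inv => [lt|[m0]|[q [v [w [[_ yw yv] rv qm]]]]].
  + by apply: Or31; apply: leq_trans lt _; apply: leq_addr.
  + by rewrite m0 in mE.
  + case: qm => [->|[i' _ ->]].
      apply: Or33; exists q, v, w; split=> //; right; exists i => //.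
      by rewrite -yv.
    (* Two certificates add at least [4 * bound] to a positive code: the block is dead. *)
    by apply: Or31; move: (bk q); case: (weightP i) (weightP i') => -> [] ->; lia.
- case/(exact_sound (isT : 0 < scode q) _ y0 (nf _ erefl)) => //.
    by rewrite mem_cat !mem_nseq !andbF.
  move=> mE [y' [-> y't y'n]].
  exists (y' ++ map inl o ++ regword b), (scode q'); split; first by rewrite -!catA.
    have y'0 : occ symC y' = 0 by move: (y'n symC); rewrite y0; lia.
    rewrite !occ_cat y'0 occ_inl !occ_nseq //.
  case: inv => [lt|[m0]|[q1 [v [w [[_ yw yv] rv qm]]]]].
  + by move: (bk q); lia.
  + by move: (bk q); lia.
  have qq : scode q1 = scode q.
    case: qm => [<-//|[i _ qm]]; move: (bk q) (bk q1) qm; rewrite mE.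
    by case: (weightP i) => ->; lia.
  move: rv; rewrite (scode_inj (src_states tin) qq) => rv.
  apply: Or33; exists q', [ffun i => v i - a i + b i], (w ++ o).
  have vE i : v i = a i + occ (rsym i) y' by rewrite -yv y'n count_erased.
  split; last by left.
    split.
    * have y'0 : occ symC y' = 0 by move: (y'n symC); rewrite y0; lia.
      by rewrite !occ_cat y'0 occ_inl !occ_nseq.
    * by rewrite 2!terminals_cat y't yw terminals_inl terminals_regword cats0.
    * by move=> i; rewrite 2!occ_cat occ_inl occ_regword ffunE vE addKn add0n.
  apply: star_r rv _; apply: MStep tin _; split=> // i.
  by rewrite vE leq_addr.
- case/(exact_sound (isT : 0 < scode q + weight i * bound) _ y0 (nf _ erefl)) => //.
  move=> mE [y' [-> y't y'n]].
  have y'0 : occ symC y' = 0 := etrans (esym (y'n symC)) y0.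
  exists (y' ++ map inl o), (scode q'); split; first by rewrite -!catA.
    by rewrite occ_cat y'0 occ_inl.
  case: inv => [lt|[m0]|[q1 [v [w [[_ yw yv] rv qm]]]]].
  + by move: (bk q) lt mE; case: (weightP i) => ->; lia.
  + by move: (bk q); lia.
  (* Codes lie between 1 and [bound], so the length determines both the code and the weight; the
     certificate is therefore one for [i]. *)
  have [qq v0] : scode q1 = scode q /\ v i = 0.
    case: qm => [qm|[i1 v1 qm]]; move: (bk q) (bk q1) qm; rewrite mE.
      by case: (weightP i) => ->; lia.
    have [/weight_inj <-|ww] := eqVneq (weight i1) (weight i); first by lia.
    by case: (weightP i) (weightP i1) ww => -> [] -> //; lia.
  move: rv; rewrite (scode_inj (src_states tin) qq) => rv.
  apply: Or33; exists q', v, (w ++ o); split; last by left.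
    split.
    * by rewrite occ_cat y'0 occ_inl.
    * by rewrite terminals_cat y't yw terminals_inl.
    * by move=> j; rewrite occ_cat occ_inl addn0 -yv y'n.
  by apply: star_r rv _; apply: MStep tin _.
Qed.

Lemma block_step rs f x z : (rs, f) \in matrices ->
  (forall F, f = Some F -> ~ factor F x) -> apply_rules rs x z ->
  scm_step counter_scm x z.
Proof. by move=> min nf ru; exists (to_matrix (rs, f)); split; [apply/In_map_mem; exists (rs, f) |]. Qed.

Lemma exact_step k s out y :
  exact_matrix k s out \in matrices -> 0 < k -> occ symC y = 0 ->
  (forall a, count_mem a s <= occ a y) ->
  exists y', [/\ scm_step counter_scm (y ++ nseq k (inr symC)) (y' ++ out),
    terminals y' = terminals y & forall a, occ a y = count_mem a s + occ a y'].
Proof.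
move=> min k0 y0 /(exact_run symC out k0)[y' [ru y't y'n]]; exists y'; split=> //.
by apply: block_step min _ ru => F [<-] /(factor_nseq k.+1 k y0); rewrite ltnn.
Qed.

Lemma trans_in t : t \in tr -> trans_matrix t \in matrices.
Proof. by move=> tin; rewrite mem_undup !inE map_f ?orbT. Qed.

(** Adding and subtracting takes one matrix; a zero test takes two, the test matrix and then the
    exact matrix that consumes its certificate. *)
Lemma run_step q v w q' v' w' y :
  mstep (@csem _) tr (q, v, w) (q', v', w') -> represents v w y ->
  exists2 y', represents v' w' y' &
    star (@scm_step _ _ counter_scm) (y ++ nseq (scode q) (inr symC))
      (y' ++ nseq (scode q') (inr symC)).
Proof.
move=> H; inversion H as [q1 o p q1' v1 v1' w1 tin sem]; subst => -[y0 yw yv].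
case: p tin sem => [[a b]|i] tin sem.
- case: sem => le vE.
  have le' c : count_mem c (nseq (a None) symA ++ nseq (a (Some tt)) symB) <= occ c y.
    have := le None; have := le (Some tt); rewrite -!yv count_cat !count_nseq.
    rewrite /rsym.
    case: (altP (c =P symA)) => [->|cA]; first by rewrite mul1n mul0n addn0.
    case: (altP (c =P symB)) => [->|cB]; first by rewrite mul0n mul1n.
    by rewrite /= ![_ == c]eq_sym (negbTE cA) (negbTE cB).
  have [y' [st y't y'n]] := exact_step (trans_in tin) isT y0 le'.
  have y'0 : occ symC y' = 0 by move: (y'n symC); rewrite y0; lia.
  exists (y' ++ map inl o ++ regword b); last by apply: rt_step; rewrite -2!catA; exact: st.
  split.
  + by rewrite !occ_cat y'0 occ_inl !occ_nseq.
  + by rewrite 2!terminals_cat y't yw terminals_inl terminals_regword cats0.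
  + move=> i; rewrite 2!occ_cat occ_inl occ_regword vE ffunE add0n; congr (_ + _).
    by rewrite -yv y'n count_erased addKn.
- case: sem => vi0 ->.
  have [||y' [st y't y'n]] := exact_step (trans_in tin) _ y0 => //.
  have y'0 : occ symC y' = 0 := etrans (esym (y'n symC)) y0.
  exists (y' ++ map inl o).
    split.
    + by rewrite occ_cat y'0 occ_inl.
    + by rewrite terminals_cat y't yw terminals_inl.
    + by move=> j; rewrite occ_cat occ_inl addn0 -yv y'n.
  rewrite -catA; apply: star_r (rt_step _ _ _ _ _) st.
  apply: (@block_step (test_matrix i).1 (test_matrix i).2).
  + by rewrite mem_undup; case: (i) => [[]|]; rewrite !inE eqxx ?orbT.
  + move=> F [<-] /factor_single; rewrite occ_cat yv vi0 occ_nseq.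
    by case: (i).
  + apply: apply_cons (apply_nil _).
    exists (y ++ nseq (scode q).-1 (inr symC)), [::].
    rewrite cats0 -!catA; split.
      by rewrite -[[:: _]]/(nseq 1 (inr symC : sym)) -nseqD addn1.
    by rewrite -nseqD; congr (_ ++ nseq _ _); rewrite /scode; lia.
Qed.

Lemma counter_scm_lang w :
  mlang (@csem _) tr q0 qf (zero _) w <-> scm_language counter_scm w.
Proof.
(* [q0] heads the list of states, so the start word C is the block of [q0] with empty registers. *)
have c0 : scode q0 = 1 by rewrite /scode /= eqxx.
split=> [H|H].
- pose P (c : Q * regs (option unit) * seq T) := exists2 y, represents c.1.2 c.2 y &
    star (@scm_step _ _ counter_scm) [:: inr symC] (y ++ nseq (scode c.1.1) (inr symC)).
  have: P (qf, zero _, w).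
    apply: (star_inv _ H); last first.
      exists [::]; last by rewrite -[_.1.1]/q0 c0; apply: rt_refl.
      by split=> // i; rewrite ffunE.
    move=> [[q v] x] [[q' v'] x'] [y yv ys] st.
    have [y' y'v y's] := run_step st yv.
    by exists y' => //; apply: rt_trans ys y's.
  case=> y [y0 yw yv] ys; apply: star_r ys _ => /=.
  have [||y' [st y't y'n]] := @exact_step (scode qf) [::] [::] y _ isT y0 => //.
    by rewrite mem_undup inE eqxx.
  suff -> : map inl w = y' ++ [::] by [].
  rewrite cats0 -[w]yw -y't.
  (* Registers at zero exclude A and B, and the block of C's has been erased, so [y'] is
     terminal. *)
  have: forall a, occ a y' = 0.
    move=> a; move: (y'n a); rewrite /= add0n => <-.
    have yA := yv None; have yB := yv (Some tt); rewrite !ffunE /= in yA yB.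
    case: a => [[|[|[|//]]] lt]; [apply: etrans _ yA | apply: etrans _ yB | apply: etrans _ y0];
      congr (occ _ y); exact: val_inj.
  elim: (y') => //= -[t|a] u IH n0.
    have E : map inl (terminals u) = u by apply: IH => a; exact: n0 a.
    by rewrite -[in RHS]E.
  by move: (n0 a); rewrite /occ /= eqxx.
- have: word_inv (map inl w).
    apply: (star_inv word_inv_step H); exists [::], 1; split=> //.
    apply: Or33; exists q0, (zero _), [::]; split; [|exact: rt_refl|by left].
    by split=> // i; rewrite ffunE.
  case=> y [m [E y0 inv]]; have m0 : m = 0.
    by move/(congr1 (occ symC)): E; rewrite occ_inl occ_cat occ_nseq mul1n; lia.
  move: E; rewrite m0 cats0 => E.
  case: inv => [|[_ [v [w' [[_ yw yv] rv]]]]|[q [v [w' [_ _ qm]]]]].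
  + by rewrite m0.
  + have vE : v = zero _ by apply/ffunP=> i; rewrite -yv -E occ_inl ffunE.
    by move: yw rv; rewrite -E terminals_inl vE => <-.
  + by exfalso; move: (scode_le q); case: qm => [|[i _]]; rewrite m0; lia.
Qed.

End CounterToSCM.

Lemma SSCM_of_RE (T : finType) (L : seq T -> Prop) :
  RE L -> SSCM (Some 0) None (Some 3) None None L.
Proof.
move/counter_of_RE=> [Q [tr [q0 [qf H]]]].
exists 3, (counter_scm tr q0 qf); split; first exact: counter_scm_wf.
split; first by move=> r /In_map_mem[m _ ->].
do 3 split=> //.
  by rewrite /= leqn0 size_filter; elim: (matrices _ _ _).
by move=> w; rewrite H; apply: counter_scm_lang.
Qed.

(** * From nonterminals in any type with decidable equality to finitely many *)

Section Renaming.
Variables (T K : eqType) (start : K) (prods : seq (seq (T + K) * seq (T + K))).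

Definition kstep (x y : seq (T + K)) : Prop :=
  exists l r u v, [/\ (l, r) \in prods, x = u ++ l ++ v & y = u ++ r ++ v].

Definition nonterms (x : seq (T + K)) : seq K :=
  pmap (fun s => if s is inr k then Some k else None) x.

Definition used_tail : seq K := flatten [seq nonterms p.1 ++ nonterms p.2 | p <- prods].

Definition ren (s : T + K) : T + 'I_(size used_tail).+1 :=
  match s with inl t => inl t | inr k => inr (inord (index k (start :: used_tail))) end.
Definition unren (s : T + 'I_(size used_tail).+1) : T + K :=
  match s with inl t => inl t | inr i => inr (nth start (start :: used_tail) i) end.

Lemma ren1K k : k \in start :: used_tail -> unren (ren (inr k)) = inr k.
Proof.
move=> kin; rewrite /unren /ren inordK ?nth_index //.
by move: kin; rewrite -index_mem.
Qed.

Lemma renK x : {subset nonterms x <= start :: used_tail} -> map unren (map ren x) = x.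
Proof.
elim: x => // -[t|k] x IH sub; rewrite !map_cons IH //.
  by rewrite ren1K //; apply: sub; apply: mem_head.
by move=> j jx; apply: sub; rewrite inE jx orbT.
Qed.

Definition renamed_grammar : ps_grammar T (size used_tail).+1 :=
  PSGrammar (inord (index start (start :: used_tail)))
    [seq (map ren p.1, map ren p.2) | p <- prods].

Lemma prods_renK l r : (l, r) \in prods ->
  map unren (map ren l) = l /\ map unren (map ren r) = r.
Proof.
move=> pin; split; apply: renK => k kx; rewrite inE; apply/orP; right;
  apply/flatten_mapP; exists (l, r); rewrite ?mem_cat ?kx ?orbT //.
Qed.

(** Both directions apply a letter map to a whole derivation. [ren] need not be injective: [unren]
    has to undo it only on the start symbol and on the productions. *)
Lemma renamed_lang w :
  star kstep [:: inr start] (map inl w) <-> ps_language renamed_grammar w.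
Proof.
split=> H.
- have := @star_sim _ _ _ (@ps_step _ _ renamed_grammar) (map ren) _ _ _ H.
  rewrite -map_comp; apply=> _ _ [l [r [u [v [pin -> ->]]]]]; apply: rt_step.
  exists (map ren l), (map ren r), (map ren u), (map ren v); rewrite -!map_cat; split=> //.
  by apply/In_map_mem; exists (l, r).
- have := @star_sim _ _ _ kstep (map unren) _ _ _ H.
  rewrite -map_comp /= inordK /= ?eqxx //; apply=> _ _ [l [r [u [v [pin [-> ->]]]]]].
  case/In_map_mem: pin => -[l' r'] pin [-> ->]; apply: rt_step.
  have [lE rE] := prods_renK pin.
  by exists l', r', (map unren u), (map unren v); rewrite !map_cat lE rE.
Qed.

End Renaming.

Lemma RE_of_kstep (T : finType) (K : eqType) (start : K)
    (prods : seq (seq (T + K) * seq (T + K))) (L : seq T -> Prop) :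
  (forall p, p \in prods -> exists k, inr k \in p.1) ->
  (forall w, L w <-> star (kstep prods) [:: inr start] (map inl w)) -> RE L.
Proof.
move=> nt H; exists (size (used_tail prods)).+1, (renamed_grammar start prods).
split; last by move=> w; rewrite H; apply: renamed_lang.
move=> p /In_map_mem[q qin ->]; have [k kin] := nt q qin.
by exists (inord (index k (start :: used_tail prods))); apply/In_mem/mapP; exists (inr k).
Qed.

(** * From an SCM grammar without permitting conditions to a grammar *)

Section SCMToGrammar.
Variables (T : finType) (n : nat) (S : 'I_n).

Local Notation sym := (T + 'I_n)%type.
Local Notation rule := ('I_n * seq sym)%type.

Variable mats : seq (seq rule * option (seq sym)).

Definition mat_step (x y : seq sym) : Prop :=
  exists rs f, [/\ (rs, f) \in mats, forall F, f = Some F -> ~ factor F x &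
    apply_rules rs x y].

Definition knt : eqType := ('I_n + nat + (seq rule + seq sym * seq rule))%type.
Definition ksym : eqType := (T + knt)%type.

Definition emb (s : sym) : ksym :=
  match s with inl t => inl t | inr a => inr (inl (inl a)) end.
Definition mS : ksym := inr (inl (inr 0)).
Definition mL : ksym := inr (inl (inr 1)).
Definition mR : ksym := inr (inl (inr 2)).
Definition mZ : ksym := inr (inl (inr 3)).
Definition hD (rs : seq rule) : ksym := inr (inr (inl rs)).
Definition hM (F : seq sym) (rs : seq rule) : ksym := inr (inr (inr (F, rs))).

(** Every production consumes exactly one head, so in a word with a single head the place of the
    rewriting is determined; the end markers are not heads. *)
Definition is_head (s : ksym) : bool :=
  match s with
  | inr (inr _) | inr (inl (inr 0)) | inr (inl (inr 3)) => true
  | _ => false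
  end.

Definition head_of (m : seq rule * option (seq sym)) : ksym :=
  if m.2 is Some F then hM F m.1 else hD m.1.

(** The added [[::]] provides the idle head even if there are no matrices. *)
Definition suffixes : seq (seq rule) :=
  rcons (flatten [seq [seq drop i m.1 | i <- iota 0 (size m.1).+1] | m <- mats]) [::].

(* A production [l h r -> rhs] with one head [h]. The word between the end markers [mL]
   and [mR] is the simulated one. The head [hD rs] walks freely and applies the rules
   [rs] that remain from the current matrix; [hM F rs] scans from left to right and
   passes a position only when [F] does not occur there. *)
Inductive qprod : seq ksym -> ksym -> seq ksym -> seq ksym -> Prop :=
| q_start : qprod [::] mS [::] [:: mL; hD [::]; emb (inr S); mR]
| q_choose m of m \in mats : qprod [:: mL] (hD [::]) [::] [:: mL; head_of m]
| q_right rs a of rs \in suffixes : qprod [::] (hD rs) [:: emb a] [:: emb a; hD rs]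
| q_left rs a of rs \in suffixes : qprod [:: emb a] (hD rs) [::] [:: hD rs; emb a]
| q_rule A w rs of (A, w) :: rs \in suffixes :
    qprod [::] (hD ((A, w) :: rs)) [:: emb (inr A)] (hD rs :: map emb w)
| q_scan F rs a s of (rs, Some F) \in mats & size (a :: s) = size F & a :: s != F :
    qprod [::] (hM F rs) (map emb (a :: s)) (emb a :: hM F rs :: map emb s)
| q_scanned F rs s of (rs, Some F) \in mats & size s < size F :
    qprod [::] (hM F rs) (map emb s ++ [:: mR]) (hD rs :: map emb s ++ [:: mR])
| q_finish : qprod [:: mL] (hD [::]) [::] [:: mZ]
| q_pass t : qprod [::] mZ [:: inl t] [:: inl t; mZ]
| q_stop : qprod [::] mZ [:: mR] [::].

Definition words k : seq (seq sym) :=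
  flatten [seq map val (enum {: i.-tuple sym}) | i <- iota 0 k.+1].

Lemma mem_words k s : (s \in words k) = (size s <= k).
Proof.
apply/flatten_mapP/idP=> [[i]|le].
  by rewrite mem_iota => lt /mapP[u _ ->]; rewrite size_tuple; lia.
exists (size s); first by rewrite mem_iota.
by apply/mapP; exists (in_tuple s); rewrite ?mem_enum.
Qed.

(** The windows have length at most that of [F], which keeps the list finite. The default of [head]
    is never met, since [s] is nonempty there. *)
Definition scan_prods (m : seq rule * option (seq sym)) :
    seq (seq ksym * ksym * seq ksym * seq ksym) :=
  if m.2 is Some F then
    [seq ([::], hM F m.1, map emb s, emb (head (inr S) s) :: hM F m.1 :: map emb (behead s))
       | s <- words (size F) & (size s == size F) && (s != F) && (s != [::])] ++
    [seq ([::], hM F m.1, map emb s ++ [:: mR], hD m.1 :: map emb s ++ [:: mR])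
       | s <- words (size F) & size s < size F]
  else [::].

Definition rule_prods (rs : seq rule) : seq (seq ksym * ksym * seq ksym * seq ksym) :=
  if rs is (A, w) :: rs' then
    [:: ([::], hD rs, [:: emb (inr A)], hD rs' :: map emb w)]
  else [::].

Definition qprods : seq (seq ksym * ksym * seq ksym * seq ksym) :=
  [:: ([::], mS, [::], [:: mL; hD [::]; emb (inr S); mR]);
      ([:: mL], hD [::], [::], [:: mZ]);
      ([::], mZ, [:: mR], [::])] ++
  [seq ([:: mL], hD [::], [::], [:: mL; head_of m]) | m <- mats] ++
  [seq ([::], hD rs, [:: emb a], [:: emb a; hD rs]) | rs <- suffixes, a <- enum {: sym}] ++
  [seq ([:: emb a], hD rs, [::], [:: hD rs; emb a]) | rs <- suffixes, a <- enum {: sym}] ++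
  flatten [seq rule_prods rs | rs <- suffixes] ++
  flatten [seq scan_prods m | m <- mats] ++
  [seq ([::], mZ, [:: inl t], [:: inl t; mZ]) | t <- enum T].

Lemma mem_qprods l h r rhs : (l, h, r, rhs) \in qprods <-> qprod l h r rhs.
Proof.
rewrite !mem_cat !inE; split.
- case/or4P; first by case/or3P=> /eqP[-> -> -> ->]; constructor.
  + by case/mapP=> m min [-> -> -> ->]; constructor.
  + by case/allpairsPdep=> rs [a [rsin _ [-> -> -> ->]]]; constructor.
  case/or4P.
  + by case/allpairsPdep=> rs [a [rsin _ [-> -> -> ->]]]; constructor.
  + case/flatten_mapP=> -[|[A w] rs] rsin //; rewrite inE => /eqP[-> -> -> ->].
    by constructor.
  + case/flatten_mapP=> -[rs [F|]] min //; rewrite /scan_prods mem_cat /=.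
    case/orP=> /mapP[s]; rewrite mem_filter.
      case/andP=> /andP[/andP[/eqP sz sF] s0] _ [-> -> -> ->].
      by case: s s0 sz sF => // a s _ sz sF; apply: q_scan.
    by case/andP=> sz _ [-> -> -> ->]; constructor.
  + by case/mapP=> t _ [-> -> -> ->]; constructor.
- case=> [|m min|rs a rsin|rs a rsin|A w rs rsin|F rs a s min sz sF|F rs s min sz||t|];
    rewrite ?eqxx ?orbT //.
  + apply/or4P/Or42/mapP; by exists m.
  + apply/or4P/Or43/allpairsPdep; exists rs, a; by rewrite mem_enum.
  + apply/or4P/Or44/or4P/Or41/allpairsPdep; exists rs, a; by rewrite mem_enum.
  + apply/or4P/Or44/or4P/Or42/flatten_mapP; exists ((A, w) :: rs) => //.
    by rewrite inE.
  + apply/or4P/Or44/or4P/Or43/flatten_mapP; exists (rs, Some F) => //.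
    rewrite /scan_prods mem_cat; apply/orP; left; apply/mapP; exists (a :: s) => //.
    by rewrite mem_filter sz eqxx sF mem_words sz leqnn.
  + apply/or4P/Or44/or4P/Or43/flatten_mapP; exists (rs, Some F) => //.
    rewrite /scan_prods mem_cat; apply/orP; right; apply/mapP; exists s => //.
    by rewrite mem_filter sz mem_words ltnW.
  + apply/or4P/Or44/or4P/Or44/mapP; exists t; by rewrite ?mem_enum.
Qed.

Definition kprods : seq (seq ksym * seq ksym) :=
  [seq (q.1.1.1 ++ q.1.1.2 :: q.1.2, q.2) | q <- qprods].

Lemma kstepP x y : kstep kprods x y <->
  exists l h r rhs u v, [/\ qprod l h r rhs, x = (u ++ l) ++ h :: (r ++ v) & y = u ++ rhs ++ v].
Proof.
split.
- move=> [l0 [r0 [u [v [/mapP[[[[l h] r] rhs] /mem_qprods q [-> ->]] -> ->]]]]].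
  by exists l, h, r, rhs, u, v; rewrite /= -!catA.
- move=> [l [h [r [rhs [u [v [/mem_qprods q -> ->]]]]]]].
  exists (l ++ h :: r), rhs, u, v; split=> //; last by rewrite -!catA.
  by apply/mapP; exists (l, h, r, rhs).
Qed.

Lemma qprod_head l h r rhs : qprod l h r rhs -> is_head h.
Proof. by case. Qed.

Definition headless (x : seq ksym) := all (predC is_head) x.

Lemma headless_emb u : headless (map emb u).
Proof. by elim: u => // -[t|a] u IH; apply: IH. Qed.

Lemma head_split u1 h1 v1 u2 h2 v2 :
  u1 ++ h1 :: v1 = u2 ++ h2 :: v2 -> is_head h1 -> headless u2 -> headless v2 ->
  [/\ u1 = u2, h1 = h2 & v1 = v2].
Proof.
elim: u1 u2 => [|a u1 IH] [|b u2] //=.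
- by case=> -> ->.
- by case=> <- _ h; rewrite /headless /= h.
- case=> _ <- h _; rewrite /headless all_cat /= h andbF //.
- by case=> -> /IH E h /andP[_ hu] hv; have [-> -> ->] := E h hu hv.
Qed.

Lemma kstep_head u0 h0 v0 y : headless u0 -> headless v0 ->
  kstep kprods (u0 ++ h0 :: v0) y ->
  exists l r rhs u v, [/\ qprod l h0 r rhs, u0 = u ++ l, v0 = r ++ v & y = u ++ rhs ++ v].
Proof.
move=> hu hv /kstepP[l [h [r [rhs [u [v [q E ->]]]]]]].
have [<- hE <-] := head_split (esym E) (qprod_head q) hu hv.
by exists l, r, rhs, u, v; rewrite -hE.
Qed.

Lemma kstep_apply l h r rhs u v u0 v0 : qprod l h r rhs ->
  u0 = u ++ l -> v0 = r ++ v -> kstep kprods (u0 ++ h :: v0) (u ++ rhs ++ v).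
Proof. by move=> q -> ->; apply/kstepP; exists l, h, r, rhs, u, v. Qed.

Definition frame h (u v : seq sym) : seq ksym :=
  (mL :: map emb u) ++ h :: (map emb v ++ [:: mR]).

Lemma emb_inj : injective emb.
Proof. by move=> [t|a] [t'|a'] // [->]. Qed.

Lemma emb_prefix v s t : map emb v ++ [:: mR] = map emb s ++ t ->
  exists2 v', v = s ++ v' & t = map emb v' ++ [:: mR].
Proof.
elim: s v => [|a s IH] v /=; first by move=> <-; exists v.
case: v => [|b v] /=; first by case: a => [?|?] [].
by case=> /emb_inj-> /IH[v' -> ->]; exists v'.
Qed.

Lemma emb_all v s t : map emb v ++ [:: mR] = (map emb s ++ [:: mR]) ++ t ->
  v = s /\ t = [::].
Proof.
rewrite -catA => /emb_prefix[[|b v'] -> /=]; first by case=> ->; rewrite cats0.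
by case: b.
Qed.

Lemma frame_left u u' : mL :: map emb u = u' ++ [:: mL] -> u = [::] /\ u' = [::].
Proof.
case: u' => [|a u']; first by case: u.
case=> _; case/lastP: u => [|u b]; first by case: u'.
by rewrite map_rcons cats1 => /eqP; rewrite eqseq_rcons andbC; case: b.
Qed.

Lemma frame_rcons u u' a : mL :: map emb u = u' ++ [:: emb a] ->
  exists2 u1, u = rcons u1 a & u' = mL :: map emb u1.
Proof.
case: u' => [|b u']; first by case: a.
case=> <-; case/lastP: u => [|u c]; first by case: u'.
rewrite map_rcons cats1 => /eqP; rewrite eqseq_rcons => /andP[/eqP<- /eqP/emb_inj->].
by exists u.
Qed.

Lemma suffixes_tail a rs : a :: rs \in suffixes -> rs \in suffixes.
Proof.
rewrite !mem_rcons !inE => /flatten_mapP[m min /mapP[i]]; rewrite mem_iota => ilt E.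
apply/orP; right; apply/flatten_mapP; exists m => //; apply/mapP; exists i.+1.
  by move/(congr1 size): E; rewrite mem_iota size_drop /=; lia.
by rewrite -addn1 addnC -drop_drop -E /= drop0.
Qed.

Lemma suffixes_mat m : m \in mats -> m.1 \in suffixes.
Proof.
move=> min; rewrite mem_rcons inE; apply/orP; right; apply/flatten_mapP; exists m => //.
by apply/mapP; exists 0; rewrite ?drop0 // mem_iota.
Qed.

Let reach := star mat_step [:: inr S].

(** The positions already passed by the scan are those of [u]; an occurrence starting there may
    extend into [v]. *)
Definition no_prefix (F u v : seq sym) :=
  forall i, i < size u -> ~~ prefix F (drop i (u ++ v)).

(** In [i_rules] the word before the matrix is forgotten: it is enough that every result of the
    remaining rules is reachable. For the idle head this says that the current word is reachable. *)
Inductive kinv : seq ksym -> Prop :=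
| i_start : kinv [:: mS]
| i_rules rs u v of (forall y, apply_rules rs (u ++ v) y -> reach y) : kinv (frame (hD rs) u v)
| i_scan F rs u v of (rs, Some F) \in mats & reach (u ++ v) & no_prefix F u v :
    kinv (frame (hM F rs) u v)
| i_final w v of reach (map inl w ++ v) :
    kinv (map inl w ++ mZ :: (map emb v ++ [:: mR]))
| i_done w of reach (map inl w) : kinv (map inl w).

(** An occurrence of [F] is too long to lie within [v], so it would start inside [u]. *)
Lemma no_prefix_factor F u v : no_prefix F u v -> size v < size F -> ~ factor F (u ++ v).
Proof.
move=> nF lt [p [q E]].
have ip : size p < size u.
  by move/(congr1 size): E; rewrite !size_cat; lia.
by move: (nF _ ip); rewrite E drop_size_cat // prefix_prefix.
Qed.

Lemma headless_frame v : headless (map emb v ++ [:: mR]).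
Proof. by rewrite /headless all_cat [all _ _]headless_emb. Qed.

Lemma headless_inl w : headless (map inl w).
Proof. by elim: w. Qed.

Lemma kinv_step x y : kinv x -> kstep kprods x y -> kinv y.
Proof.
case=> {x} [|rs u v H|F rs u v min H nF|w v H|w H].
- case/(@kstep_head [::] mS [::])=> // l [r [rhs [u [v [q]]]]].
  inversion q; subst; case: u => //= _ <- ->.
  apply: (@i_rules [::] [::] [:: inr S]) => y0 H; inversion H; subst; exact: rt_refl.
- case/kstep_head=> //; [exact: headless_emb | exact: headless_frame |].
  move=> l [r [rhs [u' [v' [q]]]]]; inversion q; subst.
  + case/frame_left=> uE -> /= <- ->; have uv := H _ (apply_nil _); rewrite uE in uv.
    case: m q H2 => m [F|] _ min.
      by apply: (@i_scan F m [::] v).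
    apply: (@i_rules m [::] v) => y0 ru; apply: star_r uv _.
    by exists m, None.
  + rewrite cats0 => <- /(@emb_prefix _ [:: a])[v1 vE ->] ->; rewrite vE in H.
    have := @i_rules rs (rcons u a) v1; rewrite cat_rcons => /(_ H).
    by rewrite /frame map_rcons -cats1 /= -!catA.
  + case/frame_rcons=> u1 uE -> /= <- ->; rewrite uE cat_rcons in H.
    by apply: (@i_rules rs u1 (a :: v) H).
  + rewrite cats0 => <- /(@emb_prefix _ [:: inr A])[v1 vE ->] ->; rewrite vE in H.
    have := @i_rules rs0 u (w ++ v1); rewrite /frame map_cat /= -!catA; apply=> y0 ru.
    by apply: H; apply: apply_cons ru; exists u, v1.
  + case/frame_left=> uE -> /= <- ->; have uv := H _ (apply_nil _); rewrite uE in uv.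
    by apply: (@i_final [::] v).
- case/kstep_head=> //; [exact: headless_emb | exact: headless_frame |].
  move=> l [r [rhs [u' [v' [q]]]]]; inversion q; subst; rewrite cats0 => <-.
  + move/(@emb_prefix _ (a :: s))=> [v1 vE ->] ->; rewrite vE in H nF.
    suff: kinv (frame (hM F rs) (rcons u a) (s ++ v1)).
      by rewrite /frame map_rcons map_cat -cats1 /= -!catA.
    apply: i_scan => //; rewrite ?cat_rcons // => i.
    (* The only new position is [size u], where the window read by the production is [a :: s], of
       the length of [F] but different from it. *)
    rewrite size_rcons ltnS leq_eqVlt cat_rcons => /orP[/eqP->|]; last exact: nF.
    by rewrite drop_size_cat // -cat_cons prefixE -H4 take_size_cat.
  + case/emb_all=> vE -> ->; rewrite cats0; apply: (@i_rules rs u s) => y0 ru.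
    rewrite vE in H nF; apply: star_r H _; exists rs, (Some F); split=> // F0 [<-].
    exact: no_prefix_factor.
- case/kstep_head=> //; [exact: headless_inl | exact: headless_frame |].
  move=> l [r [rhs [u' [v' [q]]]]]; inversion q; subst; rewrite cats0 => <-.
  + move/(@emb_prefix _ [:: inl t])=> [v1 vE ->] ->; rewrite vE in H.
    have := @i_final (rcons w t) v1; rewrite !map_rcons cat_rcons => /(_ H).
    by rewrite -cats1 -catA.
  + move/(@emb_all _ [::])=> [vE ->] ->; rewrite vE cats0 in H.
    by rewrite /= cats0; apply: i_done H.
- case/kstepP=> l [h [r [rhs [u [v [q E _]]]]]].
  by move: (headless_inl w); rewrite E /headless all_cat /= (qprod_head q) andbF.
Qed.

Local Notation run := (star (kstep kprods)).

Lemma run_right rs u a v : rs \in suffixes ->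
  kstep kprods (frame (hD rs) u (a :: v)) (frame (hD rs) (rcons u a) v).
Proof.
move=> rin.
have -> : frame (hD rs) (rcons u a) v =
    (mL :: map emb u) ++ [:: emb a; hD rs] ++ (map emb v ++ [:: mR]).
  by rewrite /frame map_rcons -cats1 /= -catA.
by apply: (kstep_apply (q_right a rin)); rewrite ?cats0.
Qed.

Lemma run_left rs u a v : rs \in suffixes ->
  kstep kprods (frame (hD rs) (rcons u a) v) (frame (hD rs) u (a :: v)).
Proof.
move=> rin; apply: (kstep_apply (q_left a rin)) => //.
by rewrite map_rcons -cats1.
Qed.

Lemma run_between rs u v : rs \in suffixes ->
  run (frame (hD rs) u v) (frame (hD rs) [::] (u ++ v)) /\
  run (frame (hD rs) [::] (u ++ v)) (frame (hD rs) u v).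
Proof.
move=> rin; elim/last_ind: u v => [|u a IH] v; first by split; apply: rt_refl.
rewrite cat_rcons; have [IH1 IH2] := IH (a :: v); split.
  exact: star_l (run_left _ _ _ rin) IH1.
exact: star_r IH2 (run_right _ _ _ rin).
Qed.

Lemma run_rules rs x y : rs \in suffixes -> apply_rules rs x y ->
  run (frame (hD rs) [::] x) (frame (hD [::]) [::] y).
Proof.
move=> rin ru; elim: ru rin => {rs x y} [x _|A w rs x z y [u [v [-> ->]]] _ IH rin].
  exact: rt_refl.
have [_ H] := run_between u (inr A :: v) rin; apply: rt_trans H _.
apply: rt_trans (IH (suffixes_tail rin)).
have [H _] := run_between u (w ++ v) (suffixes_tail rin); apply: star_l _ H.
have -> : frame (hD rs) u (w ++ v) =
    (mL :: map emb u) ++ (hD rs :: map emb w) ++ (map emb v ++ [:: mR]).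
  by rewrite /frame map_cat -catA.
by apply: (kstep_apply (q_rule rin)); rewrite ?cats0.
Qed.

(** The head advances while at least [size F] letters lie to its right; then it turns into the rule
    head and goes back to the left end. *)
Lemma run_scan F rs u v : (rs, Some F) \in mats -> ~ factor F (u ++ v) ->
  run (frame (hM F rs) u v) (frame (hD rs) [::] (u ++ v)).
Proof.
move=> min nF; have [k] := ubnP (size v); elim: k u v nF => // k IH u v nF ltk.
have rin := suffixes_mat min.
have [lt|le] := ltnP (size v) (size F).
  have [H _] := run_between u v rin; apply: star_l _ H.
  have -> : frame (hD rs) u v =
      (mL :: map emb u) ++ (hD rs :: map emb v ++ [:: mR]) ++ [::] by rewrite cats0.
  by apply: (kstep_apply (q_scanned min lt)); rewrite ?cats0.
have vE := cat_take_drop (size F) v; set s := take _ v in vE; set v1 := drop _ v in vE.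
have ss : size s = size F by rewrite size_takel.
have sF : s != F.
  apply/eqP=> sF; apply: nF; exists u, v1; by rewrite -sF vE.
case: s ss sF vE => [|a s] ss sF vE.
  (* An empty window means an empty [F], which is a factor of every word. *)
  by case: nF; exists [::], (u ++ v); move/esym/size0nil: ss => ->.
have := IH (rcons u a) (s ++ v1); rewrite cat_rcons -cat_cons vE => /(_ nF).
move=> H; apply: star_l (H _); last by move: ltk; rewrite -vE /=; lia.
have -> : frame (hM F rs) (rcons u a) (s ++ v1) =
    (mL :: map emb u) ++ (emb a :: hM F rs :: map emb s) ++ (map emb v1 ++ [:: mR]).
  by rewrite /frame map_rcons map_cat -cats1 /= -!catA.
by apply: (kstep_apply (q_scan min ss sF)); rewrite ?cats0 // -vE map_cat catA.
Qed.

Lemma run_mat_step x y : mat_step x y ->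
  run (frame (hD [::]) [::] x) (frame (hD [::]) [::] y).
Proof.
move=> [rs [f [min nF ru]]].
apply: star_l (_ : kstep _ _ (frame (head_of (rs, f)) [::] x)) _.
  by apply: (kstep_apply (u := [::]) (q_choose min)).
apply: rt_trans (run_rules (suffixes_mat min) ru).
case: f min nF => [F|] min nF; last exact: rt_refl.
by apply: run_scan min _; apply: nF.
Qed.

Lemma run_final w w' :
  run (map inl w ++ mZ :: (map emb (map inl w') ++ [:: mR])) (map inl (w ++ w')).
Proof.
elim: w' w => [|t w' IH] w.
  rewrite cats0; apply: rt_step; rewrite -[X in kstep _ _ X]cats0.
  by apply: (kstep_apply q_stop); rewrite ?cats0.
apply: star_l (_ : run (map inl (rcons w t) ++ _) _); last by rewrite -cat_rcons; apply: IH.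
rewrite map_rcons -cats1 -catA.
by apply: (kstep_apply (q_pass t)); rewrite ?cats0.
Qed.

Lemma kprods_lang w : star mat_step [:: inr S] (map inl w) <->
  run [:: mS] (map inl w).
Proof.
split=> H.
- apply: star_l (_ : kstep _ _ (frame (hD [::]) [::] [:: inr S])) _.
    by apply: (kstep_apply (u := [::]) (v := [::]) (u0 := [::]) (v0 := [::]) q_start).
  apply: rt_trans (star_sim (f := frame (hD [::]) [::]) run_mat_step H) _.
  apply: star_l (run_final [::] w).
  by apply: (kstep_apply (u := [::]) q_finish).
- have := star_inv kinv_step H i_start.
  (* Every form of the invariant except the last contains a head, hence is not a terminal word. *)
  move E: (map inl w) => x inv; case: inv E => [|rs u v _|F rs u v _ _ _|w' v _|w' H' E].
  + by case: w {H}.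
  + by case: w {H}.
  + by case: w {H}.
  + move=> E; move: (headless_inl w); rewrite E /headless all_cat /=.
    by rewrite andbF.
  + suff -> : w = w' by [].
    by move: E; apply: inj_map => ? ? [].
Qed.

Lemma kprods_nt p : p \in kprods -> exists k, inr k \in p.1.
Proof.
case/mapP=> -[[[l h] r] rhs] /mem_qprods/qprod_head hh ->.
by case: h hh => [//|k] _; exists k; rewrite mem_cat inE eqxx orbT.
Qed.

End SCMToGrammar.

(** * The two inclusions put together *)

Lemma RE_of_SCM j nn m l s (T : finType) (L : seq T -> Prop) :
  SCM (Some 0) j nn m l s L -> RE L.
Proof.
move=> [n [G [[_ wf] [deg [_ [_ [_ H]]]]]]].
(* Degree 0 leaves only the empty string as a permitting condition, and well-formedness excludes
   it. *)
have noP r : List.In r (scm_matrices G) -> permit r = None.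
  move=> rin; have [P0 _] := deg r rin; have [_ [] ] := wf r rin.
  by case: (permit r) P0 => [[|]|].
pose mats := [seq (rules r, forbid r) | r <- scm_matrices G].
have stepE x y : @scm_step T n G x y <-> mat_step mats x y.
  split=> [[r [rin [_ [nf ru]]]]|[rs [f [/In_mem/List.in_map_iff[r [[<- <-] rin]] nf ru]]]].
    exists (rules r), (forbid r); split=> //; apply/In_mem.
    exact: (List.in_map (fun r => (rules r, forbid r))).
  by exists r; split=> //; split=> // P; rewrite noP.
apply: (RE_of_kstep (@kprods_nt _ _ (scm_start G) mats)) => w.
rewrite H; apply: iff_trans (kprods_lang (scm_start G) mats w).
by split; apply: (star_sim (f := id)) => x y /stepE; apply: rt_step.
Qed.

Theorem mainTheorem10 (T : finType) (L : seq T -> Prop) :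
  SSCM (Some 0) None (Some 3) None None L <-> RE L.
Proof. by split; [apply: RE_of_SCM | apply: SSCM_of_RE]. Qed.
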